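(* Let $G/H$ be an isotropy irreducible homogeneous space of dimension $n\ge4$, where $G$ is a semisimple Lie group acting transitively, $H$ is the isotropy subgroup, and the linear isotropy representation of $H$ on the tangent space is irreducible (over $\mathbb R$). Let $\gamma$ be a $G$-invariant Riemannian metric on $G/H$. Then $\gamma$ is Einstein, and for every $m$ its Weyl tensor satisfies $$W(m)^i{}_j=\frac{n-2m}{n}\,\delta^i_j\,W(m),\qquad W(m)=\text{const.}$$
   Context: For an $n$-dimensional Riemannian manifold with metric $\gamma_{ij}$ let $C_{ij}{}^{kl}$ be its Weyl tensor, and let $\delta^{i_1\cdots i_s}_{j_1\cdots j_s}=\det(\delta^{i_a}_{j_b})$ be the generalized Kronecker delta (no factorial normalization). For an Einstein metric with $R_{ij}=(n-1)\kappa\gamma_{ij}$ one has $C_{ij}{}^{kl}=R_{ij}{}^{kl}-\kappa\,\delta^{kl}_{ij}$. Put $W(0)=1$, $W(0)^i{}_j=\delta^i_j$ and, for $s\ge1$, $$W(s)=\delta^{i_1\cdots i_{2s}}_{j_1\cdots j_{2s}}C_{i_1i_2}{}^{j_1j_2}\cdots C_{i_{2s-1}i_{2s}}{}^{j_{2s-1}j_{2s}},\qquad W(s)^i{}_j=\delta^{i\,i_1\cdots i_{2s}}_{j\,j_1\cdots j_{2s}}C_{i_1i_2}{}^{j_1j_2}\cdots C_{i_{2s-1}i_{2s}}{}^{j_{2s-1}j_{2s}}.$$ *)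

(* Defs.v *)
From HB Require Import structures.
From mathcomp Require Import all_boot all_order all_algebra.
From mathcomp Require Import all_classical all_reals all_analysis.

Set Implicit Arguments.
Unset Strict Implicit.
Unset Printing Implicit Defensive.

Import Order.TTheory GRing.Theory Num.Theory.
Import numFieldNormedType.Exports.

Local Open Scope classical_set_scope.
Local Open Scope ring_scope.

(* Vectors of R^n are row vectors: the differential of F at p is
   v |-> v *m jacobian F p. *)

Definition pderiv (R : realType) (n : nat) (V : normedModType R)
  (i : 'I_n) (f : 'rV[R]_n -> V) : 'rV[R]_n -> V :=
  fun x => 'D_(delta_mx 0 i) f x.

(* Meant for open U, where every condition below is local; all iterated partial
   derivatives being (Frechet) differentiable on U is then C^oo on U. *)
Definition smooth_on (R : realType) (n : nat) (V : normedModType R)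
  (U : set 'rV[R]_n) (f : 'rV[R]_n -> V) : Prop :=
  forall (s : seq 'I_n) (x : 'rV[R]_n), U x ->
    differentiable (foldr (@pderiv R n V) f s) x.

(* [cinv] is total; only its values on [cmap @` cdom] matter. *)
Record chart (R : realType) (T : topologicalType) (n : nat) := Chart {
  cdom : set T;
  cmap : T -> 'rV[R]_n;
  cinv : 'rV[R]_n -> T }.

Definition is_chart (R : realType) (T : topologicalType) (n : nat)
  (c : chart R T n) : Prop :=
  [/\ open (cdom c), open (cmap c @` cdom c),
      (forall x, cdom c x -> cinv c (cmap c x) = x),
      (forall x, cdom c x -> {for x, continuous (cmap c)}) &
      (forall y, (cmap c @` cdom c) y -> {for y, continuous (cinv c)})].

Definition prod_chart (R : realType) (T1 T2 : topologicalType) (n1 n2 : nat)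
  (c1 : chart R T1 n1) (c2 : chart R T2 n2) : chart R (T1 * T2)%type (n1 + n2) :=
  Chart (cdom c1 `*` cdom c2)
        (fun x => row_mx (cmap c1 x.1) (cmap c2 x.2))
        (fun v => (cinv c1 (lsubmx v), cinv c2 (rsubmx v))).

Definition in_charts (R : realType) (T1 T2 : topologicalType) (n1 n2 : nat)
  (c1 : chart R T1 n1) (c2 : chart R T2 n2) (f : T1 -> T2) :
  'rV[R]_n1 -> 'rV[R]_n2 :=
  fun v => cmap c2 (f (cinv c1 v)).

(* Matrix of the differential T_x T1 -> T_(f x) T2 in the coordinate bases. *)
Definition tangent_mx (R : realType) (T1 T2 : topologicalType) (n1 n2 : nat)
  (c1 : chart R T1 n1) (c2 : chart R T2 n2) (f : T1 -> T2) (x : T1) :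
  'M[R]_(n1, n2) :=
  jacobian (in_charts c1 c2 f) (cmap c1 x).

Definition smooth_in_charts (R : realType) (T1 T2 : topologicalType)
  (n1 n2 : nat) (I1 I2 : Type)
  (c1 : I1 -> chart R T1 n1) (c2 : I2 -> chart R T2 n2) (f : T1 -> T2) : Prop :=
  forall (i : I1) (j : I2),
    smooth_on (cmap (c1 i) @` (cdom (c1 i) `&` f @^-1` cdom (c2 j)))
              (in_charts (c1 i) (c2 j) f).

(* The atlas is the family [mchart].  [chart_at x] is a chosen chart around x:
   it makes the atlas cover, and T_x M is identified with R^n through it. *)
Record manifold (R : realType) (n : nat) := Manifold {
  mpoint :> topologicalType;
  mindex : Type;
  mchart : mindex -> chart R mpoint n;
  chart_at : mpoint -> mindex;
  manifold_hausdorff : hausdorff_space mpoint;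
  manifold_second_countable : @second_countable mpoint;
  manifold_chart : forall i, is_chart (mchart i);
  manifold_cover : forall x, cdom (mchart (chart_at x)) x;
  manifold_compat : smooth_in_charts mchart mchart (@id mpoint) }.

Definition smooth_map (R : realType) (n1 n2 : nat)
  (M : manifold R n1) (N : manifold R n2) (f : M -> N) : Prop :=
  continuous f /\ smooth_in_charts (@mchart R n1 M) (@mchart R n2 N) f.

(* Smoothness of M1 x M2 -> N for the product manifold structure. *)
Definition smooth_map2 (R : realType) (n1 n2 n3 : nat)
  (M1 : manifold R n1) (M2 : manifold R n2) (N : manifold R n3)
  (f : M1 -> M2 -> N) : Prop :=
  continuous (fun p : M1 * M2 => f p.1 p.2) /\
  smooth_in_charts
    (fun ij : mindex M1 * mindex M2 => prod_chart (mchart ij.1) (mchart ij.2))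
    (@mchart R n3 N) (fun p : M1 * M2 => f p.1 p.2).

Record lieGroup (R : realType) (d : nat) := LieGroup {
  lg_manifold :> manifold R d;
  lg_mul : lg_manifold -> lg_manifold -> lg_manifold;
  lg_one : lg_manifold;
  lg_inv : lg_manifold -> lg_manifold;
  lg_mulA : associative lg_mul;
  lg_mul1 : left_id lg_one lg_mul;
  lg_mulV : left_inverse lg_one lg_inv lg_mul;
  lg_mul_smooth : smooth_map2 lg_mul;
  lg_inv_smooth : smooth_map lg_inv }.

Arguments lg_one {R d} l.

(* Commutator X^i d_i Y - Y^i d_i X of vector fields given in coordinates. *)
Definition vf_bracket (R : realType) (d : nat)
  (X Y : 'rV[R]_d -> 'rV[R]_d) : 'rV[R]_d -> 'rV[R]_d :=
  fun x => 'D_(X x) Y x - 'D_(Y x) X x.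

(* The left-invariant field a |-> d(L_a)_1 u, for u in T_1 G, read in the chart
   around 1. *)
Definition left_inv_field (R : realType) (d : nat) (G : lieGroup R d)
  (u : 'rV[R]_d) : 'rV[R]_d -> 'rV[R]_d :=
  let c := mchart (chart_at (lg_one G)) in
  fun x => u *m tangent_mx c c (lg_mul (cinv c x)) (lg_one G).

Definition lie_bracket (R : realType) (d : nat) (G : lieGroup R d)
  (u v : 'rV[R]_d) : 'rV[R]_d :=
  vf_bracket (left_inv_field G u) (left_inv_field G v)
    (cmap (mchart (chart_at (lg_one G))) (lg_one G)).

Definition lie_ideal (R : realType) (d : nat) (G : lieGroup R d)
  (a : {vspace 'rV[R]_d}) : Prop :=
  forall u v : 'rV[R]_d, v \in a -> lie_bracket G u v \in a.

(* [a, a], spanned by the brackets of basis vectors. *)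
Definition derived_space (R : realType) (d : nat) (G : lieGroup R d)
  (a : {vspace 'rV[R]_d}) : {vspace 'rV[R]_d} :=
  (\sum_(i < \dim a) \sum_(j < \dim a)
     <[lie_bracket G (tnth (vbasis a) i) (tnth (vbasis a) j)]>)%VS.

Definition lie_solvable (R : realType) (d : nat) (G : lieGroup R d)
  (a : {vspace 'rV[R]_d}) : Prop :=
  exists k : nat, iter k (derived_space G) a = 0%VS.

Definition semisimple (R : realType) (d : nat) (G : lieGroup R d) : Prop :=
  forall a : {vspace 'rV[R]_d}, lie_ideal G a -> lie_solvable G a -> a = 0%VS.

Definition smooth_action (R : realType) (d n : nat)
  (G : lieGroup R d) (M : manifold R n) (act : G -> M -> M) : Prop :=
  [/\ (forall x, act (lg_one G) x = x),
      (forall a b x, act (lg_mul a b) x = act a (act b x)) &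
      smooth_map2 act].

Definition transitive_action (R : realType) (d n : nat)
  (G : lieGroup R d) (M : manifold R n) (act : G -> M -> M) : Prop :=
  forall x y : M, exists a : G, act a x = y.

Definition isotropy (R : realType) (d n : nat)
  (G : lieGroup R d) (M : manifold R n) (act : G -> M -> M) (o : M) : set G :=
  [set h | act h o = o].

Definition isotropy_rep (R : realType) (d n : nat)
  (G : lieGroup R d) (M : manifold R n) (act : G -> M -> M) (o : M) (h : G) :
  'M[R]_n :=
  tangent_mx (mchart (chart_at o)) (mchart (chart_at o)) (act h) o.

Definition isotropy_irreducible (R : realType) (d n : nat)
  (G : lieGroup R d) (M : manifold R n) (act : G -> M -> M) (o : M) : Prop :=
  (0 < n)%N /\
  forall V : {vspace 'rV[R]_n},
    (forall (h : G) (v : 'rV[R]_n), isotropy act o h -> v \in V ->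
       v *m isotropy_rep act o h \in V) ->
    V = 0%VS \/ V = fullv.

(* [g i y] is the matrix of components g_ab at the point with coordinates y in
   the chart i; only y in the image of the chart matters. *)
Definition metric_field (R : realType) (n : nat) (M : manifold R n) :=
  mindex M -> 'rV[R]_n -> 'M[R]_n.

(* f^* g = g, in components, for every pair of charts at x and f x. *)
Definition preserves_metric (R : realType) (n : nat) (M : manifold R n)
  (g : metric_field M) (f : M -> M) : Prop :=
  forall (i j : mindex M) (x : M),
    cdom (mchart i) x -> cdom (mchart j) (f x) ->
    let J := tangent_mx (mchart i) (mchart j) f x in
    g i (cmap (mchart i) x) = J *m g j (cmap (mchart j) (f x)) *m J^T.

(* The case f = id of [preserves_metric] is the tensor transformation law
   between charts. *)
Definition riemannian_metric (R : realType) (n : nat) (M : manifold R n)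
  (g : metric_field M) : Prop :=
  [/\ (forall i, smooth_on (cmap (mchart i) @` cdom (mchart i)) (g i)),
      (forall i y, (cmap (mchart i) @` cdom (mchart i)) y -> (g i y)^T = g i y),
      (forall i y, (cmap (mchart i) @` cdom (mchart i)) y ->
         forall v : 'rV[R]_n, v != 0 -> 0 < (v *m g i y *m v^T) 0 0) &
      preserves_metric g (@id M)].

Definition invariant_metric (R : realType) (d n : nat)
  (G : lieGroup R d) (M : manifold R n) (act : G -> M -> M)
  (g : metric_field M) : Prop :=
  forall a : G, preserves_metric g (act a).

Section Curvature.
Variables (R : realType) (n : nat) (g : 'rV[R]_n -> 'M[R]_n).
Implicit Types (x : 'rV[R]_n) (i j k l m : 'I_n).

(* Gamma^k_ij *)
Definition christoffel k i j : 'rV[R]_n -> R := fun x =>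
  2^-1 * \sum_l invmx (g x) k l *
    (pderiv i (fun y => g y j l) x + pderiv j (fun y => g y i l) x
     - pderiv l (fun y => g y i j) x).

(* R^l_kij, where R(d_i, d_j) d_k = R^l_kij d_l and
   R(X, Y) = [nabla_X, nabla_Y] - nabla_[X, Y] *)
Definition riemann l k i j x : R :=
  pderiv i (christoffel l j k) x - pderiv j (christoffel l i k) x
  + \sum_m (christoffel l i m x * christoffel m j k x
            - christoffel l j m x * christoffel m i k x).

(* R_ij^kl; for constant curvature kappa this is kappa * delta^kl_ij *)
Definition riemann_up i j k l x : R :=
  \sum_m invmx (g x) l m * riemann k m i j x.

(* R_ij = R^k_ikj *)
Definition ricci i j x : R := \sum_k riemann k i k j x.

(* R_i^k *)
Definition ricci_up i k x : R := \sum_m invmx (g x) k m * ricci m i x.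

Definition scalar_curv x : R := \sum_i ricci_up i i x.

Definition kron i j : R := (i == j)%:R.

(* C_ij^kl, the totally trace-free part of R_ij^kl *)
Definition weyl x i j k l : R :=
  riemann_up i j k l x
  - (n%:R - 2)^-1 *
      (kron i k * ricci_up j l x - kron j k * ricci_up i l x
       + kron j l * ricci_up i k x - kron i l * ricci_up j k x)
  + scalar_curv x / ((n%:R - 1) * (n%:R - 2)) *
      (kron i k * kron j l - kron i l * kron j k).

End Curvature.

(* R_ij = (n - 1) kappa g_ij with kappa constant on M *)
Definition einstein (R : realType) (n : nat) (M : manifold R n)
  (g : metric_field M) : Prop :=
  exists kappa : R, forall (c : mindex M) (x : M), cdom (mchart c) x ->
    forall i j : 'I_n,
      ricci (g c) i j (cmap (mchart c) x) =
      (n%:R - 1) * kappa * g c (cmap (mchart c) x) i j.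

Definition weyl_at (R : realType) (n : nat) (M : manifold R n)
  (g : metric_field M) (c : mindex M) (x : M) : 'I_n -> 'I_n -> 'I_n -> 'I_n -> R :=
  weyl (g c) (cmap (mchart c) x).

(* delta^{i_1 ... i_s}_{j_1 ... j_s} *)
Definition gdelta (R : realType) (n s : nat) (i j : 'I_s -> 'I_n) : R :=
  \det (\matrix_(a < s, b < s) ((i a == j b)%:R : R)).

Lemma ord_fst_subproof (s : nat) (a : 'I_s) : (a.*2 < s.*2)%N.
Proof. by rewrite ltn_double. Qed.

Lemma ord_snd_subproof (s : nat) (a : 'I_s) : (a.*2.+1 < s.*2)%N.
Proof. by rewrite ltn_Sdouble. Qed.

(* Positions (from 0) of the two indices of the a-th factor. *)
Definition ord_fst (s : nat) (a : 'I_s) : 'I_(s.*2) := Ordinal (ord_fst_subproof a).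
Definition ord_snd (s : nat) (a : 'I_s) : 'I_(s.*2) := Ordinal (ord_snd_subproof a).

(* The multi-index i i_1 ... i_s. *)
Definition idx_cons (n s : nat) (i : 'I_n) (f : 'I_s -> 'I_n) : 'I_s.+1 -> 'I_n :=
  fun a => if unlift ord0 a is Some b then f b else i.

Lemma sum_ffun0 (V : nmodType) (n : nat) (F : {ffun 'I_0 -> 'I_n} -> V) (x : V) :
  (forall f, F f = x) -> \sum_f F f = x.
Proof.
move=> Fx; rewrite (eq_bigr (fun=> x)) => [|f _]; last exact: Fx.
by rewrite sumr_const card_ffun !card_ord expn0.
Qed.

Section Contractions.
Variables (R : realType) (n : nat) (C : 'I_n -> 'I_n -> 'I_n -> 'I_n -> R).

(* C_{i_1 i_2}^{j_1 j_2} ... C_{i_{2s-1} i_{2s}}^{j_{2s-1} j_{2s}} *)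
Definition C_prod (s : nat) (i j : 'I_(s.*2) -> 'I_n) : R :=
  \prod_(a < s) C (i (ord_fst a)) (i (ord_snd a)) (j (ord_fst a)) (j (ord_snd a)).

Definition W_scalar (s : nat) : R :=
  \sum_(i : {ffun 'I_(s.*2) -> 'I_n}) \sum_(j : {ffun 'I_(s.*2) -> 'I_n})
    gdelta R i j * C_prod i j.

Definition W_tensor (s : nat) (p q : 'I_n) : R :=
  \sum_(i : {ffun 'I_(s.*2) -> 'I_n}) \sum_(j : {ffun 'I_(s.*2) -> 'I_n})
    gdelta R (idx_cons p i) (idx_cons q j) * C_prod i j.

(* The conventions W(0) = 1 and W(0)^i_j = delta^i_j are the case s = 0. *)
Lemma W_scalar0 : W_scalar 0 = 1.
Proof.
apply: sum_ffun0 => i; apply: sum_ffun0 => j.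
by rewrite /gdelta det_mx00 mul1r /C_prod big_ord0.
Qed.

Lemma W_tensor0 (p q : 'I_n) : W_tensor 0 p q = kron R p q.
Proof.
apply: sum_ffun0 => i; apply: sum_ffun0 => j.
by rewrite /gdelta det_mx11 mxE /idx_cons !unlift_none /C_prod big_ord0 mulr1.
Qed.

End Contractions.

(* Main.v *)
Require Import Defs.
From mathcomp Require Import all_boot all_order all_algebra.
From mathcomp Require Import all_classical all_reals all_analysis.
From mathcomp Require Import ring lra complex.
Import Order.TTheory GRing.Theory Num.Theory.
Import numFieldNormedType.Exports.
Local Open Scope ring_scope.

Set Implicit Arguments.
Unset Strict Implicit.
Unset Printing Implicit Defensive.

(** By naturality of the curvature, the Ricci tensor and the tensors W(m) are
    invariant under the isometries x |-> a x.  At the base point they are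
    therefore endomorphisms commuting with the isotropy representation; the
    pair symmetry of the curvature tensor makes them self-adjoint for the
    metric, so they have a real eigenvalue, and irreducibility forces them to be
    scalar.  Transitivity carries this to every point, and the contraction
    delta^{p i_1 ... i_s}_{p j_1 ... j_s} =
    (n - s) delta^{i_1 ... i_s}_{j_1 ... j_s} fixes the scalar.

    Naturality is shown in coordinates, for a change of coordinates phi with
    Jacobian J and g = J g' J^T.  In matrix form the Levi-Civita connection
    satisfies Gamma_i J = d_i J + J Theta_i with Theta_i the pulled back
    connection (by uniqueness of the torsion free metric connection), and
    differentiating once more gives R_ij J = J_ia J_jb J R'_ab. *)

(** * Generalized Kronecker delta and the contractions W *)

(** The isotropy representation is irreducible only over the reals, so its commutant may be the
    complex numbers or the quaternions, and commutation alone does not make an endomorphism scalar.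
    This is why the first Bianchi identity and both antisymmetries of the curvature are established.
    The resulting pair symmetry is phrased as a change of frame whose matrix is the metric, so that
    a single transformation rule for tensors with two lower and two upper indices yields the
    constancy of W(m), the commutation and the self-adjointness. Chart expressions are total
    functions that are meaningful only on chart images; identities are therefore proved on open sets
    and differentiated through local equality. Vectors are rows, and for each pair i, j the
    curvature is a matrix acting on the right: the indices k, l disappear into matrix products, and
    only the form indices i, j remain in explicit sums. The Einstein constant is global because the
    scalar found at the base point is transported by isometries. *)

(** Row [a] depends on the multi-index only through [i a], so in each term of the Leibniz expansion
    the sum distributes over the rows. *)
Lemma det_multilinear (R : comNzRingType) (n N : nat) (x : 'I_N -> 'I_n -> R)
    (M : 'I_N -> 'I_N -> 'I_n -> R) :
  \sum_(i : {ffun 'I_N -> 'I_n})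
     (\prod_t x t (i t)) * \det (\matrix_(a, b) M a b (i a)) =
  \det (\matrix_(a, b) \sum_k x a k * M a b k).
Proof.
rewrite /determinant; under eq_bigr do rewrite mulr_sumr.
rewrite exchange_big /=; apply: eq_bigr => s _.
under [in RHS]eq_bigr do rewrite mxE.
rewrite bigA_distr_bigA /= mulr_sumr; apply: eq_bigr => i _.
rewrite mulrCA big_split /=; congr (_ * (_ * _)).
by apply: eq_bigr => a _; rewrite mxE.
Qed.

(** [idx_cons p i] is a plain function that agrees only pointwise with the finite function it stands
    for; hence the extensionality hypothesis on [F]. *)
Lemma sum_ffun_cons (V : nmodType) (n s : nat) (F : ('I_s.+1 -> 'I_n) -> V) :
  (forall f h, f =1 h -> F f = F h) ->
  \sum_(I : {ffun 'I_s.+1 -> 'I_n}) F I =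
  \sum_p \sum_(i : {ffun 'I_s -> 'I_n}) F (idx_cons p i).
Proof.
move=> Fext; rewrite pair_big /=.
pose h (u : 'I_n * {ffun 'I_s -> 'I_n}) := [ffun a => idx_cons u.1 u.2 a].
rewrite (reindex h) /=.
  by apply: eq_bigr => u _; apply: Fext => a; rewrite ffunE.
exists (fun f => (f ord0, [ffun a => f (lift ord0 a)])).
  move=> [p i] _; congr (_, _); first by rewrite ffunE /idx_cons unlift_none.
  by apply/ffunP => a; rewrite !ffunE /idx_cons liftK.
move=> f _; apply/ffunP => a; rewrite !ffunE /idx_cons.
by case: unliftP => [b ->|->] //=; rewrite ffunE.
Qed.

Section Weyl_contractions.
Variables (R : realType) (n : nat).
Implicit Types (J K : 'M[R]_n) (T C : 'I_n -> 'I_n -> 'I_n -> 'I_n -> R).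

Lemma eq_gdelta (s : nat) (i i' j j' : 'I_s -> 'I_n) :
  i =1 i' -> j =1 j' -> gdelta R i j = gdelta R i' j'.
Proof. by move=> ei ej; congr (\det _); apply/matrixP=> a b; rewrite !mxE ei ej. Qed.

Lemma gdeltaC (s : nat) (i j : 'I_s -> 'I_n) : gdelta R i j = gdelta R j i.
Proof. by rewrite /gdelta -det_tr; congr (\det _); apply/matrixP=> a b; rewrite !mxE eq_sym. Qed.

Lemma sum_kron_l (k : 'I_n) (f : 'I_n -> R) : \sum_l (l == k)%:R * f l = f k.
Proof.
by rewrite (bigD1 k) //= eqxx mul1r big1 ?addr0 // => l /negPf->; rewrite mul0r.
Qed.

(** Applying [det_multilinear] once to the lower and once to the upper multi-index leaves the
    determinant of entries of [K *m J], which are Kronecker deltas. *)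
Lemma gdelta_transform J K (N : nat) (i' j' : 'I_N -> 'I_n) : K *m J = 1%:M ->
  \sum_(i : {ffun 'I_N -> 'I_n}) \sum_(j : {ffun 'I_N -> 'I_n})
     (\prod_t J (i t) (i' t)) * gdelta R i j * \prod_t K (j' t) (j t) =
  gdelta R i' j'.
Proof.
move=> KJ; rewrite exchange_big /=.
have -> : gdelta R i' j' =
    \det (\matrix_(b, a) \sum_k K (j' b) k * J k (i' a)).
  rewrite gdeltaC; congr (\det _); apply/matrixP => b a; rewrite !mxE.
  have /matrixP/(_ (j' b) (i' a)) := KJ; rewrite !mxE => <-.
  by [].
rewrite -(det_multilinear (fun b k => K (j' b) k) (fun b a k => J k (i' a))).
apply: eq_bigr => j _; rewrite -mulr_suml mulrC; congr (_ * _).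
rewrite (det_multilinear (fun t k => J k (i' t)) (fun a b k => (k == j b)%:R)).
rewrite -det_tr; congr (\det _); apply/matrixP => b a; rewrite !mxE.
by under eq_bigr do rewrite mulrC; rewrite sum_kron_l.
Qed.

(* The lower indices i, j transform with J and the upper indices k, l with K. *)
Definition tensor22_transform J K T T' := forall i j k l,
  T i j k l = \sum_a \sum_b \sum_c \sum_d
    J i a * J j b * T' a b c d * (K c k * K d l).

(** Groups a multi-index by the factors of [C_prod]: a product of [m] sums over pairs expands, by
    [bigA_distr_bigA], into a sum over functions from factors to pairs. *)
Definition unpair_idx (m : nat) (f : {ffun 'I_m -> 'I_n * 'I_n}) :
    {ffun 'I_m.*2 -> 'I_n} :=
  [ffun t : 'I_m.*2 => let u := f (Ordinal (etrans (ltn_half_double t m) (ltn_ord t))) in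
     if odd t then u.2 else u.1].

Lemma unpair_idx_fst m (f : {ffun 'I_m -> 'I_n * 'I_n}) a :
  unpair_idx f (ord_fst a) = (f a).1.
Proof.
rewrite ffunE /= odd_double; congr (f _).1; apply/val_inj => /=.
exact: doubleK.
Qed.

Lemma unpair_idx_snd m (f : {ffun 'I_m -> 'I_n * 'I_n}) a :
  unpair_idx f (ord_snd a) = (f a).2.
Proof.
rewrite ffunE /= odd_double /=; congr (f _).2; apply/val_inj => /=.
exact: uphalf_double.
Qed.

Lemma prod_doubled m (F : 'I_m.*2 -> R) :
  \prod_t F t = \prod_a (F (ord_fst a) * F (ord_snd a)).
Proof.
pose h (u : 'I_m * bool) := if u.2 then ord_snd u.1 else ord_fst u.1.
have hK (t : 'I_m.*2) :
    h (Ordinal (etrans (ltn_half_double t m) (ltn_ord t)), odd t) = t.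
  apply/val_inj; rewrite /h /=; case: ifP => /= ot;
    by rewrite -[RHS](odd_double_half t) ot.
rewrite (reindex h) /=; last first.
  exists (fun t : 'I_m.*2 => (Ordinal (etrans (ltn_half_double t m) (ltn_ord t)), odd t)).
    move=> [a b] _; rewrite /h; case: b => /=; congr (_, _);
      rewrite ?odd_double //; apply/val_inj => /=.
      exact: uphalf_double.
    exact: doubleK.
  by move=> t _; exact: hK.
rewrite -(pair_big predT predT (fun a b => F (h (a, b)))) /=.
by apply: eq_bigr => a _; rewrite big_bool mulrC.
Qed.

Lemma sum_unpair_idx (V : nmodType) m (F : {ffun 'I_m.*2 -> 'I_n} -> V) :
  \sum_i F i = \sum_(f : {ffun 'I_m -> 'I_n * 'I_n}) F (unpair_idx f).
Proof.
rewrite (reindex (@unpair_idx m)) //=.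
exists (fun i : {ffun 'I_m.*2 -> 'I_n} => [ffun a => (i (ord_fst a), i (ord_snd a))]).
  move=> f _; apply/ffunP => a; rewrite ffunE unpair_idx_fst unpair_idx_snd.
  by case: (f a).
move=> i _; apply/ffunP => t; rewrite !ffunE /=; case ot: (odd t);
  rewrite ?ffunE /=; congr (i _); apply/val_inj => /=;
  by rewrite -{2}(odd_double_half t) ot.
Qed.

Lemma sum_pair4 (F : 'I_n -> 'I_n -> 'I_n -> 'I_n -> R) :
  \sum_a \sum_b \sum_c \sum_d F a b c d =
  \sum_(u : 'I_n * 'I_n) \sum_(v : 'I_n * 'I_n) F u.1 u.2 v.1 v.2.
Proof.
rewrite pair_big /=; apply: eq_bigr => u _.
by rewrite pair_big.
Qed.

Lemma C_prod_transform J K T T' m (i j : 'I_m.*2 -> 'I_n) :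
  tensor22_transform J K T T' ->
  C_prod T i j =
  \sum_(i' : {ffun 'I_m.*2 -> 'I_n}) \sum_(j' : {ffun 'I_m.*2 -> 'I_n})
    (\prod_t J (i t) (i' t)) * C_prod T' i' j' * \prod_t K (j' t) (j t).
Proof.
move=> TT'; rewrite sum_unpair_idx.
under [RHS]eq_bigr do rewrite sum_unpair_idx.
rewrite /C_prod; under [LHS]eq_bigr do rewrite TT' sum_pair4.
rewrite bigA_distr_bigA /=; apply: eq_bigr => f _.
rewrite bigA_distr_bigA /=; apply: eq_bigr => h _.
rewrite !prod_doubled -!big_split /=; apply: eq_bigr => a _.
by rewrite !unpair_idx_fst !unpair_idx_snd.
Qed.

(** Both sides become the same sum over four multi-indices: on the right the delta is replaced by
    its own transform, on the left every factor of [C_prod] is expanded. *)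
Lemma W_scalar_transform J K T T' m : K *m J = 1%:M ->
  tensor22_transform J K T T' -> W_scalar T m = W_scalar T' m.
Proof.
move=> KJ TT'; rewrite /W_scalar.
under [RHS]eq_bigr => i' _ do under eq_bigr => j' _ do
  rewrite -(gdelta_transform i' j' KJ) mulr_suml.
under [RHS]eq_bigr => i' _ do under eq_bigr => j' _ do
  under eq_bigr => i _ do rewrite mulr_suml.
under [LHS]eq_bigr => i _ do under eq_bigr => j _ do rewrite (C_prod_transform i j TT') mulr_sumr.
under [LHS]eq_bigr => i _ do under eq_bigr => j _ do
  under eq_bigr => i' _ do rewrite mulr_sumr.
rewrite pair_big.
under [RHS]eq_bigr => i' _ do under eq_bigr => j' _ do rewrite pair_big.
under [LHS]eq_bigr => u _ do rewrite pair_big.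
rewrite exchange_big [RHS]pair_big /=.
apply: eq_bigr => -[i' j'] _; apply: eq_bigr => -[i j] _ /=.
ring.
Qed.

(* Rows carry the lower index, like the tangent matrices. *)
Definition W_mx T m : 'M[R]_n := \matrix_(q, p) W_tensor T m p q.

Lemma prod_idx_cons s J p q (i i' : 'I_s -> 'I_n) :
  \prod_t J (idx_cons p i t) (idx_cons q i' t) = J p q * \prod_t J (i t) (i' t).
Proof.
rewrite big_ord_recl /idx_cons !unlift_none; congr (_ * _).
by apply: eq_bigr => a _; rewrite !liftK.
Qed.

Lemma gdelta_cons_transform J K s p q (i' j' : 'I_s -> 'I_n) : K *m J = 1%:M ->
  gdelta R (idx_cons p i') (idx_cons q j') =
  \sum_r \sum_t J r p * K q t *
   \sum_(i : {ffun 'I_s -> 'I_n}) \sum_(j : {ffun 'I_s -> 'I_n})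
     (\prod_a J (i a) (i' a)) * gdelta R (idx_cons r i) (idx_cons t j)
       * \prod_a K (j' a) (j a).
Proof.
move=> KJ; rewrite -(gdelta_transform _ _ KJ).
rewrite (sum_ffun_cons (F := fun I => \sum_(j0 : {ffun _}) (\prod_t J (I t) (idx_cons p i' t)) * gdelta R I j0 * \prod_t K (idx_cons q j' t) (j0 t))); last first.
  move=> f h fh; apply: eq_bigr => j0 _; congr (_ * _ * _).
    by apply: eq_bigr => t _; rewrite fh.
  exact: eq_gdelta.
apply: eq_bigr => r _.
under eq_bigr => i _.
  rewrite (sum_ffun_cons (F := fun h => (\prod_t J (idx_cons r i t) (idx_cons p i' t)) * gdelta R (idx_cons r i) h * \prod_t K (idx_cons q j' t) (h t))); last first.
    move=> f h fh; congr (_ * _); last by apply: eq_bigr => t _; rewrite fh.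
    by congr (_ * _); exact: eq_gdelta.
  over.
rewrite exchange_big /=; apply: eq_bigr => t _; rewrite mulr_sumr.
apply: eq_bigr => i _; rewrite mulr_sumr; apply: eq_bigr => j _.
rewrite !prod_idx_cons; ring.
Qed.

(** Serves three times: with [J] in the isotropy representation it gives commutation, with the
    metric as [J] self-adjointness, with the tangent matrix of a translation the passage from one
    point to another. *)
Lemma W_mx_transform J K T T' m : K *m J = 1%:M ->
  tensor22_transform J K T T' -> W_mx T' m = K *m W_mx T m *m J.
Proof.
move=> KJ TT'; apply/matrixP => q p; rewrite !mxE.
under [RHS]eq_bigr => r _ do rewrite mxE mulr_suml.
rewrite /W_tensor.
under [LHS]eq_bigr => i' _ do under eq_bigr => j' _ do
  rewrite (gdelta_cons_transform p q i' j' KJ) pair_big mulr_suml.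
rewrite pair_big exchange_big [RHS]pair_big /=; apply: eq_bigr => -[r t] _ /=.
rewrite mxE /W_tensor.
rewrite [RHS]mulrAC [RHS]mulr_sumr.
under [RHS]eq_bigr => i _ do rewrite mulr_sumr.
rewrite [RHS]pair_big /=.
under [RHS]eq_bigr => ij _.
  rewrite (C_prod_transform _ _ TT') pair_big /= mulr_sumr mulr_sumr.
  over.
rewrite /= exchange_big /=; apply: eq_bigr => -[i' j'] _ /=.
rewrite pair_big /= mulr_sumr mulr_suml; apply: eq_bigr => -[i j] _ /=.
ring.
Qed.

End Weyl_contractions.

Section Weyl_contraction_identities.
Variables (R : realType) (n : nat).
Implicit Types (J K A B : 'M[R]_n) (T C : 'I_n -> 'I_n -> 'I_n -> 'I_n -> R).

(** Expansion along the first column. The corner entry is 1 for each of the [n] values of [p]; the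
    entry in row [lift ord0 a] forces [p = i a], where the cofactor is [- gdelta R i j], so each of
    the [s] rows removes one copy. *)
Lemma gdelta_trace s (i j : 'I_s -> 'I_n) :
  \sum_p gdelta R (idx_cons p i) (idx_cons p j) =
  (n%:R - s%:R) * gdelta R i j.
Proof.
pose M p : 'M[R]_s.+1 := \matrix_(a, b) (idx_cons p i a == idx_cons p j b)%:R.
have M00 p : cofactor (M p) ord0 ord0 = gdelta R i j.
  rewrite /cofactor addn0 expr0 mul1r; congr (\det _).
  by apply/matrixP => a b; rewrite !mxE /idx_cons !liftK.
have Ml a : cofactor (M (i a)) (lift ord0 a) ord0 = - gdelta R i j.
  rewrite -(M00 (i a)).
  (* N has two equal rows, and the same cofactors along its first column as M. *)
  pose N : 'M[R]_s.+1 := \matrix_(r, c)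
    if c == ord0 then ((r == ord0) || (r == lift ord0 a))%:R else M (i a) r c.
  have NM r : cofactor N r ord0 = cofactor (M (i a)) r ord0.
    rewrite /cofactor; congr (_ * \det _); apply/matrixP => b c.
    by rewrite !mxE eq_sym (negPf (neq_lift _ _)).
  have : \det N = 0.
    apply: (@determinant_alternate _ _ _ ord0 (lift ord0 a)); first exact: neq_lift.
    move=> c; rewrite !mxE !eqxx orbT /=; case: ifP => // c0.
    by rewrite /idx_cons unlift_none liftK.
  rewrite (expand_det_col N ord0) big_ord_recl (bigD1 a) //= big1 ?addr0.
    rewrite !mxE !eqxx orbT !mul1r !NM => /eqP; rewrite addrC addr_eq0 => /eqP.
    by [].
  move=> b ba; rewrite mxE eqxx (inj_eq lift_inj) (negPf ba) orbF.
  by rewrite eq_sym (negPf (neq_lift _ _)) mul0r.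
under eq_bigr => p _.
  rewrite -/(M p) /gdelta (expand_det_col (M p) ord0) big_ord_recl M00.
  rewrite {1}/M mxE /idx_cons unlift_none eqxx mul1r.
  under eq_bigr => a _.
    have -> : M p (lift ord0 a) ord0 = (p == i a)%:R.
      by rewrite mxE /idx_cons unlift_none liftK eq_sym.
    over.
  over.
rewrite big_split /= sumr_const card_ord exchange_big /=.
under [X in _ + X]eq_bigr => a _.
  rewrite (sum_kron_l (i a) (fun p => cofactor (M p) (lift ord0 a) ord0)) Ml.
  over.
rewrite sumr_const card_ord mulrBl !mulr_natl mulNrn; congr (_ - _).
Qed.

Lemma W_tensor_trace T m :
  \sum_p W_tensor T m p p = (n%:R - 2 * m%:R) * W_scalar T m.
Proof.
rewrite /W_tensor /W_scalar exchange_big /= mulr_sumr; apply: eq_bigr => i _.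
rewrite exchange_big /= mulr_sumr; apply: eq_bigr => j _.
by rewrite -mulr_suml gdelta_trace mulrA -natrM mul2n.
Qed.

Lemma W_mx_tr T m : W_mx (fun i j k l => T k l i j) m = (W_mx T m)^T.
Proof.
apply/matrixP => q p; rewrite !mxE /W_tensor exchange_big /=.
by apply: eq_bigr => i _; apply: eq_bigr => j _; rewrite gdeltaC.
Qed.

Lemma tensor22_transformD J K T1 T1' T2 T2' :
  tensor22_transform J K T1 T1' -> tensor22_transform J K T2 T2' ->
  tensor22_transform J K (fun i j k l => T1 i j k l + T2 i j k l)
    (fun i j k l => T1' i j k l + T2' i j k l).
Proof.
move=> h1 h2 i j k l; rewrite h1 h2 -big_split /=; apply: eq_bigr => a _.
rewrite -big_split /=; apply: eq_bigr => b _.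
rewrite -big_split /=; apply: eq_bigr => c _.
rewrite -big_split /=; apply: eq_bigr => d _; ring.
Qed.

Lemma tensor22_transformZ J K r T T' :
  tensor22_transform J K T T' ->
  tensor22_transform J K (fun i j k l => r * T i j k l)
    (fun i j k l => r * T' i j k l).
Proof.
move=> h i j k l; rewrite h mulr_sumr; apply: eq_bigr => a _.
rewrite mulr_sumr; apply: eq_bigr => b _.
rewrite mulr_sumr; apply: eq_bigr => c _.
rewrite mulr_sumr; apply: eq_bigr => d _; ring.
Qed.

Lemma mulmx3_entry J A K i k :
  (J *m A *m K) i k = \sum_a \sum_c J i a * A a c * K c k.
Proof.
rewrite mxE exchange_big /=; apply: eq_bigr => c _.
by rewrite mxE mulr_suml.
Qed.

Lemma tensor22_transform_prod J K A A' B B' :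
  A = J *m A' *m K -> B = J *m B' *m K ->
  tensor22_transform J K (fun i j k l => A i k * B j l)
    (fun i j k l => A' i k * B' j l).
Proof.
move=> -> -> i j k l; rewrite !mulmx3_entry mulr_suml; apply: eq_bigr => a _.
rewrite mulr_sumr; apply: eq_bigr => b _.
rewrite mulr_suml; apply: eq_bigr => c _.
rewrite mulr_sumr; apply: eq_bigr => d _; ring.
Qed.

Lemma tensor22_transform_crossprod J K A A' B B' :
  A = J *m A' *m K -> B = J *m B' *m K ->
  tensor22_transform J K (fun i j k l => A i l * B j k)
    (fun i j k l => A' i l * B' j k).
Proof.
move=> -> -> i j k l; rewrite !mulmx3_entry mulr_suml; apply: eq_bigr => a _.
rewrite mulr_sumr; apply: eq_bigr => b _.
rewrite exchange_big mulr_suml; apply: eq_bigr => d _.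
rewrite mulr_sumr; apply: eq_bigr => c _; ring.
Qed.

End Weyl_contraction_identities.

(** * A Schur lemma over the reals for self-adjoint endomorphisms *)

(** Irreducibility is applied to one eigenspace only, so the work lies in producing a real
    eigenvalue. It is extracted from a complex one by self-adjointness for the inner product [h]. *)
Lemma real_schur (R : realType) (n : nat) (h A : 'M[R]_n) (S : 'M[R]_n -> Prop) :
  (0 < n)%N -> h^T = h -> (forall v : 'rV_n, v != 0 -> 0 < (v *m h *m v^T) 0 0) ->
  (A *m h)^T = A *m h ->
  (forall J, S J -> J *m A = A *m J) ->
  (forall V : {vspace 'rV[R]_n},
     (forall J v, S J -> v \in V -> v *m J \in V) -> V = 0%VS \/ V = fullv) ->
  exists a, A = a%:M.
Proof.
move=> n0 hT hpos AhT SA irr.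
have [a [v v0 vA]] : exists a, exists2 v : 'rV[R]_n, v != 0 & v *m A = a *: v.
  (* As [n > 0], the characteristic polynomial has a complex root [a + i b]; [x] and [y] are the
     real and imaginary parts of an eigenvector. *)
  pose Ac := map_mx (fun x => x%:C)%C A.
  have /closed_rootP[[a b]] : size (char_poly Ac) != 1%N.
    by rewrite size_char_poly eqSS -lt0n.
  rewrite -eigenvalue_root_char => /eigenvalueP[w wA w0].
  pose x := map_mx (@complex.Re R) w; pose y := map_mx (@complex.Im R) w.
  have xA : x *m A = a *: x - b *: y.
    apply/rowP => k; have := congr1 (fun u : 'rV_n => complex.Re (u 0 k)) wA.
    rewrite !mxE raddf_sum /= => e; apply: (eq_trans _ (eq_trans e _)); last by case: (w 0 k).
    apply: eq_bigr => l _; rewrite !mxE.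
    by case: (w 0 l) => ? ? /=; rewrite mulr0 subr0.
  have yA : y *m A = a *: y + b *: x.
    apply/rowP => k; have := congr1 (fun u : 'rV_n => complex.Im (u 0 k)) wA.
    rewrite !mxE raddf_sum /= => e; apply: (eq_trans _ (eq_trans e _)); last by case: (w 0 k).
    apply: eq_bigr => l _; rewrite !mxE.
    by case: (w 0 l) => ? ? /=; rewrite mulr0 add0r.
  pose ip (u v : 'rV[R]_n) := (u *m h *m v^T) 0 0.
  have ipC u v : ip u v = ip v u.
    have -> : ip u v = (u *m h *m v^T)^T 0 0 by rewrite mxE.
    by rewrite !trmx_mul trmxK hT mulmxA.
  have ipl s u t u' v : ip (s *: u + t *: u') v = s * ip u v + t * ip u' v.
    by rewrite /ip !mulmxDl -!scalemxAl !mxE.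
  have ipA u v : ip (u *m A) v = ip u (v *m A).
    rewrite /ip trmx_mul -!mulmxA; congr ((u *m _) 0 0); rewrite !mulmxA.
    by rewrite -[A *m h]AhT trmx_mul hT.
  have ipge0 u : 0 <= ip u u.
    by have [->|/hpos/ltW//] := eqVneq u 0; rewrite /ip !mul0mx mxE.
  (* Self-adjointness applied to [x] and [y] reads [a ip x y - b ip y y = a ip x y + b ip x x].
     Definiteness then gives [b = 0], and whichever of [x], [y] is nonzero is a real eigenvector. *)
  have : b * (ip x x + ip y y) = 0.
    have := ipA x y; rewrite xA yA -scaleNr (ipC x) !ipl (ipC y x).
    by move=> e; nra.
  have [b0 _|b0 /eqP] := eqVneq b 0.
    have [x0|x0] := eqVneq x 0.
      exists a, y; last by rewrite yA b0 scale0r addr0.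
      apply: contra_neq w0 => y0; apply/rowP => k.
      move/rowP/(_ k): x0; move/rowP/(_ k): y0; rewrite !mxE.
      by case: (w 0 k) => ? ? /= -> ->.
    by exists a, x => //; rewrite xA b0 scale0r subr0.
  rewrite mulf_eq0 (negPf b0) /= paddr_eq0 // => /andP[/eqP x0 /eqP y0].
  case/eqP: w0; apply/rowP => k.
  have zero u : ip u u = 0 -> u = 0.
    by move=> u0; apply/eqP/negPn/negP => /hpos; rewrite -/(ip u u) u0 ltxx.
  move/zero/rowP/(_ k): x0; move/zero/rowP/(_ k): y0; rewrite !mxE.
  by case: (w 0 k) => ? ? /= -> ->.
exists a.
(* The eigenspace of [a]: stable under everything that commutes with [A], and nonzero because it
   contains [v]. *)
pose V := lker (linfun (mulmxr (A - a%:M)) : 'Hom('rV[R]_n, 'rV[R]_n)).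
have inV u : (u \in V) = (u *m A == a *: u).
  by rewrite memv_ker lfunE /= mulmxBr mul_mx_scalar subr_eq0.
have [J u SJ|V0|Vf] := irr V.
- by rewrite !inV => /eqP uA; rewrite -mulmxA SA // mulmxA uA scalemxAl.
- by move: v0; rewrite -memv0 -V0 inV vA eqxx.
apply/row_matrixP => i; rewrite !rowE.
have : delta_mx 0 i \in V by rewrite Vf memvf.
by rewrite inV => /eqP->; rewrite mul_mx_scalar.
Qed.

(** * Partial derivatives *)

(** The first order expansion at [x] sees only the germ of the function. This lets formulas valid on
    a chart image be used for the total functions that extend them. *)
Lemma near_eq_differentiable (R : numFieldType) (V W : normedModType R)
    (f g : V -> W) (x : V) :
  {near x, f =1 g} -> differentiable f x -> differentiable g x.
Proof.
move=> fg df; have [fc fe] := (diff_locallyP x f).1 df.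
have ge : g \o shift x = cst (g x) + 'd f x +o_ 0 id.
  apply/eqaddoP => e e0.
  move/eqaddoP/(_ e e0): fe.
  have fgs : \forall h \near (0 : V), f (h + x) = g (h + x).
    by move: fg; rewrite (near_shift 0) subr0.
  apply: filterS2 fgs => h fgh.
  have -> // : (g \o shift x - (cst (g x) + 'd f x)) h =
      (f \o shift x - (cst (f x) + 'd f x)) h.
  by move: (nbhs_singleton fg) => /= fgx; rewrite -[LHS]/(g (h + x) - (g x + 'd f x h)) -fgx -fgh.
by apply/diff_locallyP; rewrite (diff_unique fc ge).
Qed.

Section pderiv_calculus.
Variables (R : realType) (n : nat).
Implicit Types (U : set 'rV[R]_n) (x : 'rV[R]_n) (i j : 'I_n).

Lemma near_open U x (P : 'rV[R]_n -> Prop) : open U -> U x ->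
  (forall y, U y -> P y) -> \forall y \near x, P y.
Proof. by move=> oU Ux UP; apply: filterS UP _; exact: open_nbhs_nbhs. Qed.

Lemma smooth_on_pderiv (V : normedModType R) U (f : 'rV[R]_n -> V) i :
  smooth_on U f -> smooth_on U (pderiv i f).
Proof.
by move=> fs s x Ux; have := fs (rcons s i) x Ux; rewrite foldr_rcons.
Qed.

Lemma smooth_on_differentiable (V : normedModType R) U (f : 'rV[R]_n -> V) x :
  smooth_on U f -> U x -> differentiable f x.
Proof. by move=> fs; exact: (fs [::]). Qed.

Lemma pderiv_coord p q (F : 'rV[R]_n -> 'M[R]_(p, q)) i x a b :
  differentiable F x ->
  pderiv i (fun y => F y a b) x = pderiv i F x a b.
Proof.
by move=> dF; rewrite /pderiv derive_mx ?mxE //; exact: diff_derivable.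
Qed.

Lemma differentiable_entry p q (F : 'rV[R]_n -> 'M[R]_(p, q)) x a b :
  differentiable F x -> differentiable (fun y => F y a b) x.
Proof.
move=> dF; apply: (@differentiable_comp _ _ _ _ F (fun N : 'M[R]_(p, q) => N a b)) => //.
exact: differentiable_coord.
Qed.

Lemma smooth_on_entry p q U (F : 'rV[R]_n -> 'M[R]_(p, q)) a b :
  open U -> smooth_on U F -> smooth_on U (fun y => F y a b).
Proof.
move=> oU Fs s.
have E : forall y, U y ->
    foldr (@pderiv R n R) (fun y => F y a b) s y = foldr (@pderiv R n _) F s y a b.
  elim: s => [//|i s IH] y Uy /=; rewrite -(pderiv_coord _ _ _ (Fs s y Uy)).
  by apply: near_eq_derive; exact: near_open IH.
move=> x Ux; apply: near_eq_differentiable (differentiable_entry a b (Fs s x Ux)).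
by apply: near_open oU Ux _ => y Uy; rewrite E.
Qed.

Lemma diff_pderivE p (W : normedModType R) (F : 'rV[R]_p -> W) z (u : 'rV[R]_p) :
  differentiable F z -> 'd F z u = \sum_a u 0 a *: pderiv a F z.
Proof.
move=> dF; rewrite {1}(row_sum_delta u) linear_sum; apply: eq_bigr => a _.
by rewrite linearZ /= /pderiv deriveE.
Qed.

Lemma jacobianE p (phi : 'rV[R]_n -> 'rV[R]_p) x i a :
  differentiable phi x -> jacobian phi x i a = pderiv i phi x 0 a.
Proof. by move=> dphi; rewrite /pderiv deriveEjacobian // -rowE [RHS]mxE. Qed.

Lemma pderiv_comp p (W : normedModType R) (phi : 'rV[R]_n -> 'rV[R]_p)
    (F : 'rV[R]_p -> W) x i :
  differentiable phi x -> differentiable F (phi x) ->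
  pderiv i (fun y => F (phi y)) x = \sum_a jacobian phi x i a *: pderiv a F (phi x).
Proof.
move=> dphi dF; rewrite {1}/pderiv deriveE; last exact: differentiable_comp.
rewrite diff_comp //= diff_pderivE //; apply: eq_bigr => a _.
by rewrite jacobianE // -(deriveE _ dphi).
Qed.

Lemma differentiable_prod (V : normedModType R) (I : Type) (r : seq I) (f : I -> V -> R) (x : V) :
  (forall k, differentiable (f k) x) ->
  differentiable (fun y => \prod_(k <- r) f k y) x.
Proof.
move=> df; elim: r => [|k r IH].
  rewrite (_ : (fun y => _) = cst 1); first exact: differentiable_cst.
  by apply/funext => y; rewrite big_nil.
rewrite (_ : (fun y => _) = (f k * (fun y => \prod_(k <- r) f k y))).
  exact: differentiableM.
by apply/funext => y; rewrite big_cons.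
Qed.

Lemma differentiable_bigsum (V W : normedModType R) (I : Type) (r : seq I) (f : I -> V -> W) (x : V) :
  (forall k, differentiable (f k) x) ->
  differentiable (fun y => \sum_(k <- r) f k y) x.
Proof.
move=> df; elim: r => [|k r IH].
  rewrite (_ : (fun y => _) = cst 0); first exact: differentiable_cst.
  by apply/funext => y; rewrite big_nil.
rewrite (_ : (fun y => _) = (f k + (fun y => \sum_(k <- r) f k y))).
  exact: differentiableD.
by apply/funext => y; rewrite big_cons.
Qed.

Lemma differentiable_det (V : normedModType R) p (A : V -> 'M[R]_p) (x : V) :
  (forall a b, differentiable (fun y => A y a b) x) ->
  differentiable (fun y => \det (A y)) x.
Proof.
move=> dA; apply: differentiable_bigsum => s.
apply: differentiableM; first exact: differentiable_cst.
by apply: differentiable_prod => k.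
Qed.

(** Cramer's formula. Invertibility is asked near [x], because [invmx] returns its argument at a
    singular matrix. *)
Lemma differentiable_invmx (V : normedModType R) p (A : V -> 'M[R]_p) (x : V) k l :
  (forall a b, differentiable (fun y => A y a b) x) ->
  (\forall y \near x, A y \in unitmx) ->
  differentiable (fun y => invmx (A y) k l) x.
Proof.
move=> dA uA.
apply: (@near_eq_differentiable _ _ _
  ((fun y => (\det (A y))^-1) * (fun y => cofactor (A y) l k))).
  by apply: filterS uA => y uAy; rewrite /invmx uAy !mxE.
apply: differentiableM.
  apply: differentiableV; first exact: differentiable_det.
  by have := nbhs_singleton uA; rewrite unitmxE unitfE.
rewrite /cofactor; apply: differentiableM; first exact: differentiable_cst.
apply: differentiable_det => a b.
rewrite (_ : (fun y => _) = (fun y => A y (lift l a) (lift k b))) //.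
by apply/funext => y; rewrite !mxE.
Qed.

Lemma derivable_mulmx (V : normedModType R) p q r (A : V -> 'M[R]_(p, q))
    (B : V -> 'M[R]_(q, r)) (x v : V) :
  derivable A x v -> derivable B x v -> derivable (fun y => A y *m B y) x v.
Proof.
move=> /derivable_mxP dA /derivable_mxP dB; apply/derivable_mxP => a b.
rewrite (_ : (fun y => _) = \sum_(k < q) ((fun y => A y a k) * (fun y => B y k b))).
  by apply: derivable_sum => k; exact: derivableM.
by apply/funext => y; rewrite mxE fct_sumE.
Qed.

Lemma derive_mulmx (V : normedModType R) p q r (A : V -> 'M[R]_(p, q))
    (B : V -> 'M[R]_(q, r)) (x v : V) :
  derivable A x v -> derivable B x v ->
  'D_v (fun y => A y *m B y) x = 'D_v A x *m B x + A x *m 'D_v B x.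
Proof.
move=> dA dB; rewrite !derive_mx //; last exact: derivable_mulmx.
move/derivable_mxP in dA; move/derivable_mxP in dB.
apply/matrixP => a b; rewrite !mxE.
rewrite (_ : (fun y => _) = \sum_(k < q) ((fun y => A y a k) * (fun y => B y k b))).
  rewrite derive_sum => [|k]; last exact: derivableM.
  rewrite -big_split /=; apply: eq_bigr => k _.
  by rewrite deriveM // !mxE addrC; congr (_ + _); rewrite mulrC.
by apply/funext => y; rewrite mxE fct_sumE.
Qed.

Lemma derivable_trmx (V : normedModType R) p q (A : V -> 'M[R]_(p, q)) (x v : V) :
  derivable A x v -> derivable (fun y => (A y)^T) x v.
Proof.
move=> /derivable_mxP dA; apply/derivable_mxP => a b.
by rewrite (_ : (fun y => _) = (fun y => A y b a)) //; apply/funext => y; rewrite mxE.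
Qed.

Lemma derive_trmx (V : normedModType R) p q (A : V -> 'M[R]_(p, q)) (x v : V) :
  derivable A x v -> 'D_v (fun y => (A y)^T) x = ('D_v A x)^T.
Proof.
move=> dA; rewrite !derive_mx //; last exact: derivable_trmx.
apply/matrixP => a b; rewrite !mxE; congr ('D_v _ x).
by apply/funext => y; rewrite mxE.
Qed.

End pderiv_calculus.

(** * Symmetry of second partial derivatives *)

Section schwarz.
Variables (R : realType) (n : nat).
Implicit Types (U : set 'rV[R]_n) (x z v : 'rV[R]_n) (i j : 'I_n).
Local Notation e_ i := (delta_mx 0 i : 'rV[R]_n).

Lemma MVT_line (F : 'rV[R]_n -> R) z v (t : R) : 0 < t ->
  (forall s, 0 <= s <= t -> differentiable F (s *: v + z)) ->
  exists2 s, 0 < s < t & F (t *: v + z) - F z = t * 'D_v F (s *: v + z).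
Proof.
move=> t0 dF; pose h s := F (s *: v + z).
have hE s : (fun k => k^-1 *: ((h \o shift s) (k *: 1) - h s)) =
    (fun k => k^-1 *: ((F \o shift (s *: v + z)) (k *: v) - F (s *: v + z))).
  apply/funext => k; rewrite /h /=; congr (_ *: (F _ - _)).
  by rewrite scalerDl [k *: 1]mulr1 addrA.
have dh s : 0 <= s <= t -> is_derive s 1 h ('D_v F (s *: v + z)).
  move=> st; split; last by rewrite /derive hE.
  by have := @diff_derivable _ _ _ F _ v (dF s st); rewrite /derivable hE.
have ds s : s \in `]0, t[ -> is_derive s 1 h ('D_v F (s *: v + z)).
  by rewrite in_itv /= => /andP[s0 st]; apply: dh; rewrite !ltW.
have hc : {within `[0, t], continuous h}%classic.
  apply: derivable_within_continuous => s; rewrite in_itv /= => st.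
  by have [] := dh s st.
have [s] := MVT t0 ds hc; rewrite in_itv /= => st.
by rewrite /h scale0r add0r subr0 mulrC; exists s.
Qed.

Lemma derive_translate (F : 'rV[R]_n -> R) c v x :
  'D_v (fun y => F (c + y)) x = 'D_v F (c + x).
Proof.
have E : (fun h : R => h^-1 *: (((fun y => F (c + y)) \o shift x) (h *: v) - F (c + x))) =
    (fun h => h^-1 *: ((F \o shift (c + x)) (h *: v) - F (c + x))).
  by apply/funext => h /=; rewrite addrCA.
by rewrite /derive E.
Qed.

(** The mean value theorem twice: in direction [i] for the increment [f (t *: e_ j + y) - f y] as a
    function of [y], then in direction [j] for [pderiv i f]. *)
Lemma second_difference U (f : 'rV[R]_n -> R) i j x (t : R) :
  smooth_on U f -> 0 < t ->
  (forall s s', 0 <= s <= t -> 0 <= s' <= t -> U (s' *: e_ j + (s *: e_ i + x))) ->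
  exists s s', [/\ 0 <= s <= t, 0 <= s' <= t &
    f (t *: e_ j + (t *: e_ i + x)) - f (t *: e_ i + x)
      - (f (t *: e_ j + x) - f x) =
    t * (t * pderiv j (pderiv i f) (s' *: e_ j + (s *: e_ i + x)))].
Proof.
move=> fs t0 UP.
have tt : 0 <= t <= t by rewrite lexx ltW.
have zz : 0 <= (0 : R) <= t by rewrite lexx ltW.
have dft s : 0 <= s <= t -> differentiable f (t *: e_ j + (s *: e_ i + x)).
  by move=> st; apply: smooth_on_differentiable fs (UP _ _ st tt).
have df0 s : 0 <= s <= t -> differentiable f (s *: e_ i + x).
  by move=> st; have := smooth_on_differentiable fs (UP _ _ st zz); rewrite scale0r add0r.
pose sh y := t *: e_ j + y.
have dsh y : differentiable sh y.
  by apply: differentiableD.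
have dF s : 0 <= s <= t -> differentiable (fun y => f (sh y) - f y) (s *: e_ i + x).
  move=> st; apply: differentiableB; last exact: df0.
  by apply: differentiable_comp => //; exact: dft.
have [s st] := MVT_line t0 dF.
have -> : 'D_(e_ i) (fun y => f (sh y) - f y) (s *: e_ i + x) =
   pderiv i f (t *: e_ j + (s *: e_ i + x)) - pderiv i f (s *: e_ i + x).
  have st' : 0 <= s <= t by case/andP: st => ? ?; rewrite !ltW.
  rewrite -[LHS]/('D_(e_ i) ((f \o sh) - f) (s *: e_ i + x)) deriveB.
  - by rewrite /pderiv (derive_translate f).
  - by apply/diff_derivable/differentiable_comp => //; exact: dft.
  - by apply/diff_derivable; exact: df0.
move=> E.
have st' : 0 <= s <= t by case/andP: st => ? ?; rewrite !ltW.
have [s' st2 E2] := @MVT_line (pderiv i f) (s *: e_ i + x) (e_ j) t t0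
  (fun s' h => smooth_on_differentiable (smooth_on_pderiv i fs) (UP _ _ st' h)).
exists s, s'; split => //; first by case/andP: st2 => ? ?; rewrite !ltW.
by rewrite E /sh E2.
Qed.

Lemma nbhs_square i j x (W : set 'rV[R]_n) : nbhs x W ->
  exists2 t : R, 0 < t & forall s s', 0 <= s <= t -> 0 <= s' <= t ->
    W (s' *: e_ j + (s *: e_ i + x)).
Proof.
(* When [i = j] both displacements fall on the same coordinate and add up to at most [2 * r / 3],
   still less than [r]. *)
move=> /nbhs_ballP[r /= r0 rW]; exists (r / 3) => [|s s' /andP[s0 st] /andP[s0' st']].
  by rewrite divr_gt0.
apply: rW; split=> // a b; rewrite !mxE /ball /= -normrN opprB.
rewrite ltr_norml.
case: (a == 0); case: (b == j); case: (b == i); rewrite /= ?mulr1 ?mulr0; apply/andP; split; lra.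
Qed.

Lemma eq_of_close (a b : R) :
  (forall e, 0 < e -> exists c, `|a - c| < e /\ `|b - c| < e) -> a = b.
Proof.
move=> H; apply/eqP/negPn/negP => ne.
have e0 : 0 < `|a - b| / 2 by rewrite divr_gt0 // normr_gt0 subr_eq0.
have [c []] := H _ e0; rewrite (distrC b) => ac cb.
by have := le_lt_trans (ler_distD c a b) (ltrD ac cb); rewrite -splitr ltxx.
Qed.

(* The mixed second difference of f over a small square is t ^ 2 times either
   mixed derivative at some point of the square. *)
Lemma pderivC U (f : 'rV[R]_n -> R) i j x : open U -> smooth_on U f -> U x ->
  pderiv i (pderiv j f) x = pderiv j (pderiv i f) x.
Proof.
move=> oU fs Ux.
have dij : differentiable (pderiv i (pderiv j f)) x by exact: (fs [:: i; j]).
have dji : differentiable (pderiv j (pderiv i f)) x by exact: (fs [:: j; i]).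
have cij := differentiable_continuous dij; have cji := differentiable_continuous dji.
apply: eq_of_close => e e0.
move/cvgrPdist_lt/(_ e e0) : cij => cij; move/cvgrPdist_lt/(_ e e0) : cji => cji.
have nU : nbhs x U by exact: open_nbhs_nbhs.
have [t t0 H] := nbhs_square i j (filterI nU (filterI cij cji)).
have [s [s' [st st' E]]] := second_difference fs t0 (fun s s' h h' => (H s s' h h').1).
have H' : forall s s', 0 <= s <= t -> 0 <= s' <= t -> U (s' *: e_ i + (s *: e_ j + x)).
  by move=> r r' rt rt'; rewrite addrCA; have [] := H r' r rt' rt.
have [r [r' [rt rt' E']]] := second_difference fs t0 H'.
have [_ [_ Hji]] := H _ _ st st'.
have [_ [Hij _]] := H _ _ rt' rt.
rewrite (addrCA (r *: e_ j)) in Hij.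
have EE : pderiv j (pderiv i f) (s' *: e_ j + (s *: e_ i + x)) =
    pderiv i (pderiv j f) (r' *: e_ i + (r *: e_ j + x)).
  move: E E'; move: (pderiv j _ _) (pderiv i _ _) => A B E E'.
  have tn0 : t != 0 by rewrite gt_eqF.
  apply: (mulfI tn0); apply: (mulfI tn0); rewrite -E -E' (addrCA (t *: e_ i)).
  by rewrite !opprB !addrA; ring.
exists (pderiv i (pderiv j f) (r' *: e_ i + (r *: e_ j + x))).
by split; [exact: Hij | rewrite -EE; exact: Hji].
Qed.

End schwarz.

(** * Connection and curvature of a metric in coordinates *)

Section entrywise_smooth.
Variables (R : realType) (n : nat).
Implicit Types (U : set 'rV[R]_n) (x : 'rV[R]_n) (i j : 'I_n).

Lemma smooth_on_eq (V : normedModType R) U (f f' : 'rV[R]_n -> V) : open U ->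
  (forall y, U y -> f y = f' y) -> smooth_on U f -> smooth_on U f'.
Proof.
move=> oU ff' fs s.
have E : forall y, U y -> foldr (@pderiv R n V) f s y = foldr (@pderiv R n V) f' s y.
  elim: s => [//|i s IH] y Uy /=.
  by apply: near_eq_derive; exact: near_open IH.
move=> x Ux; apply: near_eq_differentiable (fs s x Ux).
exact: near_open E.
Qed.

(** Smoothness entry by entry: this is the form in which it is obtained for a Jacobian, whose
    entries are partial derivatives, and in which [pderivC] applies. *)
Definition mx_smooth_on p q U (F : 'rV[R]_n -> 'M[R]_(p, q)) :=
  forall a b, smooth_on U (fun y => F y a b).

Lemma smooth_on_mx p q U (F : 'rV[R]_n -> 'M[R]_(p, q)) :
  open U -> smooth_on U F -> mx_smooth_on U F.
Proof. by move=> oU Fs a b; exact: smooth_on_entry. Qed.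

Lemma derivable_entries (V : normedModType R) p q (F : V -> 'M[R]_(p, q)) (x v : V) :
  (forall a b, differentiable (fun y => F y a b) x) -> derivable F x v.
Proof. by move=> dF; apply/derivable_mxP => a b; exact: diff_derivable. Qed.

Lemma mx_smooth_on_derivable p q U (F : 'rV[R]_n -> 'M[R]_(p, q)) x v :
  mx_smooth_on U F -> U x -> derivable F x v.
Proof.
move=> Fs Ux; apply: derivable_entries => a b.
exact: smooth_on_differentiable (Fs a b) Ux.
Qed.

Lemma mx_smooth_on_pderivE p q U (F : 'rV[R]_n -> 'M[R]_(p, q)) x i :
  mx_smooth_on U F -> U x ->
  pderiv i F x = \matrix_(a, b) pderiv i (fun y => F y a b) x.
Proof.
by move=> Fs Ux; rewrite {1}/pderiv derive_mx //; exact: mx_smooth_on_derivable Fs Ux.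
Qed.

Lemma mx_smooth_on_pderiv p q U (F : 'rV[R]_n -> 'M[R]_(p, q)) i : open U ->
  mx_smooth_on U F -> mx_smooth_on U (pderiv i F).
Proof.
move=> oU Fs a b; apply: (smooth_on_eq oU _ (smooth_on_pderiv i (Fs a b))).
by move=> y Uy; rewrite (mx_smooth_on_pderivE i Fs Uy) mxE.
Qed.

Lemma mx_pderivC p q U (F : 'rV[R]_n -> 'M[R]_(p, q)) i j x : open U ->
  mx_smooth_on U F -> U x -> pderiv i (pderiv j F) x = pderiv j (pderiv i F) x.
Proof.
move=> oU Fs Ux.
rewrite !(mx_smooth_on_pderivE _ (mx_smooth_on_pderiv _ oU Fs) Ux).
have E k l a b : pderiv k (fun y => pderiv l F y a b) x =
    pderiv k (pderiv l (fun y => F y a b)) x.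
  apply: near_eq_derive; apply: near_open oU Ux _ => y Uy.
  by rewrite (mx_smooth_on_pderivE l Fs Uy) mxE.
apply: eq_mx => a b.
rewrite (E i j a b).
rewrite (E j i a b).
exact: pderivC oU (Fs a b) Ux.
Qed.

End entrywise_smooth.

Section koszul.
Variables (R : realType) (n : nat).
Implicit Types (g : 'M[R]_n) (dg H : 'I_n -> 'M[R]_n).

(** The Christoffel symbols, Γ^k_ij standing in row [j] and column [k] of the [i]-th matrix. The
    derivatives of the metric are a free argument [dg], so compatibility and uniqueness become
    matrix algebra at one point. *)
Definition koszul g dg i : 'M[R]_n := \matrix_(j, k)
  (2^-1 * \sum_l invmx g k l * (dg i j l + dg j i l - dg l i j)).

Lemma koszul_sym g dg i j k : (forall i, (dg i)^T = dg i) ->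
  koszul g dg i j k = koszul g dg j i k.
Proof.
move=> dgT; rewrite !mxE; congr (_ * _); apply: eq_bigr => l _; congr (_ * _).
have -> : dg l i j = dg l j i by rewrite -{1}(dgT l) mxE.
by rewrite (addrC (dg i j l)).
Qed.

Lemma koszul_mulmx g dg i j l : g \in unitmx -> g^T = g ->
  (koszul g dg i *m g) j l = 2^-1 * (dg i j l + dg j i l - dg l i j).
Proof.
move=> ug gT.
pose v : 'cV[R]_n := \col_m (dg i j m + dg j i m - dg m i j).
have -> : koszul g dg i = \matrix_(j, k)
   (2^-1 *: (invmx g *m \col_m (dg i j m + dg j i m - dg m i j))) k 0.
  by apply/matrixP => a b; rewrite !mxE; congr (_ * _); apply: eq_bigr => m _; rewrite mxE.
transitivity ((g *m (2^-1 *: (invmx g *m v))) l 0).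
  by rewrite !mxE; apply: eq_bigr => m _; rewrite mxE mulrC -{1}gT mxE.
by rewrite -scalemxAr mulmxA mulmxV // mul1mx !mxE.
Qed.

Lemma koszul_compat g dg i : g \in unitmx -> g^T = g ->
  (forall i, (dg i)^T = dg i) ->
  dg i = koszul g dg i *m g + (koszul g dg i *m g)^T.
Proof.
move=> ug gT dgT; have S k a b : dg k a b = dg k b a by rewrite -{1}dgT mxE.
apply/matrixP => j l; rewrite [RHS]mxE [(_^T) _ _]mxE !koszul_mulmx //.
by rewrite (S i l j); field.
Qed.

(** Written through the lowered [H], the sum [dg i j l + dg j i l - dg l i j] has six terms; by
    symmetry in the first two indices four cancel in pairs and the other two are equal to
    [(H i *m g) j l]. *)
Lemma koszul_unique g dg H : g \in unitmx -> g^T = g ->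
  (forall i j k, H i j k = H j i k) ->
  (forall i, dg i = H i *m g + (H i *m g)^T) ->
  forall i, H i = koszul g dg i.
Proof.
move=> ug gT Hsym Hc i.
have hs a b l : (H a *m g) b l = (H b *m g) a l.
  by rewrite !mxE; apply: eq_bigr => m _; rewrite Hsym.
apply: (can_inj (mulmxK ug)); apply/matrixP => j l; rewrite koszul_mulmx //.
have HcE a b c : dg a b c = (H a *m g) b c + (H a *m g) c b.
  by rewrite {1}Hc mxE [(_^T) _ _]mxE.
by rewrite !HcE (hs j i l) (hs l i j) (hs l j i); field.
Qed.

End koszul.

(** The algebra behind the antisymmetry of R_ijkl in k, l. Here [A], [B] stand for ∂_iΓ_j, ∂_jΓ_i
    and [P], [Q] for Γ_i, Γ_j; the hypothesis says that the second derivatives of the metric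
    commute. The mixed terms [X] and [X^T] occur on both sides and cancel. *)
Lemma antisym_of_commuting_pderiv (R : realType) (n : nat) (G A B P Q : 'M[R]_n) :
  G^T = G ->
  A *m G + Q *m (P *m G + (P *m G)^T) + (A *m G + Q *m (P *m G + (P *m G)^T))^T =
  B *m G + P *m (Q *m G + (Q *m G)^T) + (B *m G + P *m (Q *m G + (Q *m G)^T))^T ->
  (A - B + (Q *m P - P *m Q)) *m G + ((A - B + (Q *m P - P *m Q)) *m G)^T = 0.
Proof.
move=> GT; pose X := Q *m G *m P^T.
have -> : Q *m (P *m G + (P *m G)^T) = Q *m P *m G + X.
  by rewrite mulmxDr trmx_mul GT !mulmxA.
have -> : P *m (Q *m G + (Q *m G)^T) = P *m Q *m G + X^T.
  by rewrite mulmxDr /X !trmx_mul trmxK GT !mulmxA.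
have -> : (A - B + (Q *m P - P *m Q)) *m G =
    A *m G - B *m G + (Q *m P *m G - P *m Q *m G) by rewrite !mulmxDl !mulNmx.
move: (A *m G) (B *m G) (Q *m P *m G) (P *m Q *m G) X => {}A {}B Y Z X.
move=> /matrixP h; apply/matrixP => a b; have := h a b; rewrite !mxE; lra.
Qed.

Definition local_metric (R : realType) (n : nat) (U : set 'rV[R]_n)
    (g : 'rV[R]_n -> 'M[R]_n) : Prop :=
  [/\ open U, mx_smooth_on U g, (forall y, U y -> (g y)^T = g y) &
      forall y, U y -> g y \in unitmx].

Section local_metric_theory.
Variables (R : realType) (n : nat) (U : set 'rV[R]_n) (g : 'rV[R]_n -> 'M[R]_n).
Hypothesis gU : local_metric U g.
Implicit Types (x : 'rV[R]_n) (i j k l : 'I_n).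

Let oU : open U. Proof. by case: gU. Qed.
Let gs : mx_smooth_on U g. Proof. by case: gU. Qed.
Let gT y : U y -> (g y)^T = g y. Proof. by case: gU => _ _ H _; exact: H. Qed.
Let gu y : U y -> g y \in unitmx. Proof. by case: gU => _ _ _; exact. Qed.

Definition connection_mx i (y : 'rV[R]_n) : 'M[R]_n :=
  koszul (g y) (fun l => pderiv l g y) i.

(** Row [k], column [l] is R^l_kij. The products stand in the order opposite to the commutator of
    Γ_i and Γ_j because these matrices act on row vectors from the right. *)
Definition curvature_mx i j (x : 'rV[R]_n) : 'M[R]_n :=
  pderiv i (connection_mx j) x - pderiv j (connection_mx i) x
  + (connection_mx j x *m connection_mx i x - connection_mx i x *m connection_mx j x).

Lemma pderiv_metric_tr i y : U y -> (pderiv i g y)^T = pderiv i g y.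
Proof.
move=> Uy; rewrite /pderiv -derive_trmx; last exact: mx_smooth_on_derivable gs Uy.
by apply: near_eq_derive; apply: near_open oU Uy _.
Qed.

Lemma pderiv_metric_entry y i a b : U y ->
  pderiv i (fun z => g z a b) y = pderiv i g y a b.
Proof. by move=> Uy; rewrite (mx_smooth_on_pderivE i gs Uy) [RHS]mxE. Qed.

Lemma christoffelE k i j y : U y -> christoffel g k i j y = connection_mx i y j k.
Proof.
move=> Uy; rewrite [RHS]mxE /christoffel; congr (_ * _); apply: eq_bigr => l _.
by rewrite (pderiv_metric_entry i j l Uy) (pderiv_metric_entry j i l Uy) (pderiv_metric_entry l i j Uy).
Qed.

Lemma connection_sym i j k y : U y -> connection_mx i y j k = connection_mx j y i k.
Proof. by move=> Uy; apply: koszul_sym => l; exact: pderiv_metric_tr. Qed.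

Lemma connection_compat i y : U y ->
  pderiv i g y = connection_mx i y *m g y + (connection_mx i y *m g y)^T.
Proof.
move=> Uy; apply: (koszul_compat (dg := fun l => pderiv l g y)); rewrite ?gu ?gT //.
by move=> l; exact: pderiv_metric_tr.
Qed.

Lemma differentiable_connection i j k x : U x ->
  differentiable (fun y => connection_mx i y j k) x.
Proof.
move=> Ux; rewrite (_ : (fun y => _) =
  (fun y => 2^-1 * \sum_l invmx (g y) k l *
     (pderiv i g y j l + pderiv j g y i l - pderiv l g y i j))); last first.
  by apply/funext => y; rewrite /connection_mx mxE.
have dp a b c : differentiable (fun y => pderiv a g y b c) x.
  exact: (smooth_on_differentiable (mx_smooth_on_pderiv a oU gs b c) Ux).
apply: differentiableM; first exact: differentiable_cst.
apply: differentiable_bigsum => l; apply: differentiableM.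
  apply: differentiable_invmx => [a b|]; first exact: smooth_on_differentiable (gs a b) Ux.
  exact: near_open oU Ux gu.
by apply: differentiableB; first apply: differentiableD.
Qed.

Lemma derivable_connection i x v : U x -> derivable (connection_mx i) x v.
Proof.
by move=> Ux; apply: derivable_entries => a b; exact: differentiable_connection.
Qed.

Lemma riemannE l k i j x : U x -> riemann g l k i j x = curvature_mx i j x k l.
Proof.
move=> Ux.
have E a b c d : pderiv a (christoffel g d b c) x = pderiv a (connection_mx b) x c d.
  rewrite [in RHS]/pderiv derive_mx; last exact: derivable_connection.
  rewrite mxE; apply: near_eq_derive; apply: near_open oU Ux _ => y Uy.
  exact: christoffelE.
rewrite /riemann /curvature_mx (E i j k l) (E j i k l).
have cE a b c : christoffel g a b c x = connection_mx b x c a by exact: christoffelE.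
have -> : \sum_m (christoffel g l i m x * christoffel g m j k x
    - christoffel g l j m x * christoffel g m i k x) =
    \sum_m (connection_mx j x k m * connection_mx i x m l
    - connection_mx i x k m * connection_mx j x m l).
  by apply: eq_bigr => m _; rewrite !cE [in X in X - _]mulrC [in X in _ - X]mulrC.
move: (pderiv i _ x) (pderiv j _ x) (connection_mx i x) (connection_mx j x) => A B P Q.
by rewrite !mxE sumrB.
Qed.

Lemma curvature_antisym_ij i j x : curvature_mx j i x = - curvature_mx i j x.
Proof. by rewrite /curvature_mx opprD !opprB. Qed.

(** Torsion freeness makes both ∂_aΓ_b and Γ_bΓ_a symmetric in [b] and the row index, so the cyclic
    sum cancels in pairs. *)
Lemma curvature_bianchi i j k l x : U x ->
  curvature_mx i j x k l + curvature_mx j k x i l + curvature_mx k i x j l = 0.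
Proof.
move=> Ux.
have E a b c d : pderiv a (connection_mx b) x c d = pderiv a (connection_mx c) x b d.
  rewrite /pderiv !derive_mx; try exact: derivable_connection.
  rewrite mxE [RHS]mxE; apply: near_eq_derive; apply: near_open oU Ux _ => y Uy.
  exact: connection_sym.
have M a b c d : (connection_mx b x *m connection_mx a x) c d =
    (connection_mx c x *m connection_mx a x) b d.
  by rewrite !mxE; apply: eq_bigr => m _; rewrite (connection_sym b c m Ux).
rewrite /curvature_mx; pose dP a b := pderiv a (connection_mx b) x.
pose PP a b := connection_mx b x *m connection_mx a x.
rewrite -!/(dP _ _) -!/(PP _ _).
have {}E a b c d : dP a b c d = dP a c b d by exact: E.
have {}M a b c d : PP a b c d = PP a c b d by exact: M.
move: dP PP E M => dP PP E M; rewrite !mxE.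
rewrite (E i j k) (E j i k) (E k j i) (M i j k) (M j i k) (M k j i); ring.
Qed.

Lemma curvature_antisym_kl i j x : U x ->
  curvature_mx i j x *m g x + (curvature_mx i j x *m g x)^T = 0.
Proof.
move=> Ux.
have dg v : derivable g x v by exact: mx_smooth_on_derivable gs Ux.
have dG a v : derivable (connection_mx a) x v by exact: derivable_connection.
have D a b : pderiv a (pderiv b g) x =
    pderiv a (connection_mx b) x *m g x + connection_mx b x *m pderiv a g x
    + (pderiv a (connection_mx b) x *m g x + connection_mx b x *m pderiv a g x)^T.
  have -> : pderiv a (pderiv b g) x =
     pderiv a (fun y => connection_mx b y *m g y + (connection_mx b y *m g y)^T) x.
    by apply: near_eq_derive; apply: near_open oU Ux _ => y Uy; exact: connection_compat.
  have dM : derivable (fun y => connection_mx b y *m g y) x (delta_mx 0 a).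
    exact: derivable_mulmx.
  have dMT := derivable_trmx dM.
  have := deriveD dM dMT; rewrite (derive_trmx dM) (derive_mulmx (dG b _) (dg _)).
  exact.
have := mx_pderivC i j oU gs Ux; rewrite (D i j) (D j i).
rewrite (connection_compat i Ux) (connection_compat j Ux) /curvature_mx.
exact: antisym_of_commuting_pderiv (gT Ux).
Qed.

End local_metric_theory.

(** * Change of coordinates *)

(* Differentiating [P_i J = D_i + J T_i] and antisymmetrizing kills the second
   derivatives of the coordinate change. *)
Lemma curvature_gauge (R : realType) (n : nat)
    (J Pi Pj Di Dj Ti Tj DD dPij dPji dTij dTji : 'M[R]_n) :
  Pi *m J = Di + J *m Ti -> Pj *m J = Dj + J *m Tj ->
  dPij *m J + Pj *m Di = DD + (Di *m Tj + J *m dTij) ->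
  dPji *m J + Pi *m Dj = DD + (Dj *m Ti + J *m dTji) ->
  (dPij - dPji + (Pj *m Pi - Pi *m Pj)) *m J =
  J *m (dTij - dTji + (Tj *m Ti - Ti *m Tj)).
Proof.
move=> Ei Ej Eij Eji; rewrite !mulmxDl !mulNmx.
have -> : Pj *m Pi *m J = Pj *m Di + (Dj *m Ti + J *m Tj *m Ti).
  by rewrite -mulmxA Ei mulmxDr mulmxA Ej mulmxDl.
have -> : Pi *m Pj *m J = Pi *m Dj + (Di *m Tj + J *m Ti *m Tj).
  by rewrite -mulmxA Ej mulmxDr mulmxA Ei mulmxDl.
rewrite !mulmxDr !mulmxN !mulmxA.
move: Eij Eji {Ei Ej}.
move: (dPij *m J) (dPji *m J) (Pj *m Di) (Pi *m Dj) (Di *m Tj) (Dj *m Ti).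
move: (J *m dTij) (J *m dTji) (J *m Tj *m Ti) (J *m Ti *m Tj).
move=> a b c d e f h k l m /matrixP E1 /matrixP E2; apply/matrixP => p q.
move: (E1 p q) (E2 p q); rewrite !mxE; lra.
Qed.

Section derive_scale.
Variables (R : realType) (V : normedModType R) (p q : nat).
Implicit Types (s : V -> R) (A : V -> 'M[R]_(p, q)) (x v : V).

Lemma derivable_scale s A x v : derivable s x v -> derivable A x v ->
  derivable (fun y => s y *: A y) x v.
Proof.
move=> ds /derivable_mxP dA; apply/derivable_mxP => a b.
have -> : (fun y => (s y *: A y) a b) = s * (fun y => A y a b).
  by apply/funext => y; rewrite mxE.
exact: derivableM ds (dA a b).
Qed.

Lemma derive_scale s A x v : derivable s x v -> derivable A x v ->
  'D_v (fun y => s y *: A y) x = 'D_v s x *: A x + s x *: 'D_v A x.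
Proof.
move=> ds dA; rewrite (derive_mx dA) (derive_mx (derivable_scale ds dA)).
move/derivable_mxP in dA; apply/matrixP => a b.
rewrite mxE [RHS]mxE [X in _ = X + _]mxE [X in _ = _ + X]mxE [X in _ + _ * X]mxE.
have -> : (fun y => (s y *: A y) a b) = s * (fun y => A y a b).
  by apply/funext => y; rewrite mxE.
rewrite (deriveM ds (dA a b)) addrC; congr (_ + _); exact: mulrC.
Qed.

End derive_scale.

Section coordinate_change.
Variables (R : realType) (n : nat) (U V : set 'rV[R]_n).
Variables (phi : 'rV[R]_n -> 'rV[R]_n) (g g' : 'rV[R]_n -> 'M[R]_n).
Hypothesis gU : local_metric U g.
Hypothesis gV : local_metric V g'.
Hypothesis phis : smooth_on U phi.
Hypothesis phiUV : forall y, U y -> V (phi y).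
Hypothesis ggJ : forall y, U y ->
  g y = jacobian phi y *m g' (phi y) *m (jacobian phi y)^T.
Implicit Types (x : 'rV[R]_n) (i j k l a b : 'I_n).

Local Notation J := (jacobian phi).

Let oU : open U. Proof. by case: gU. Qed.

Lemma jacobian_pderiv i a y : U y -> J y i a = pderiv i (fun z => phi z 0 a) y.
Proof.
move=> Uy; have dphi := smooth_on_differentiable phis Uy.
by rewrite (jacobianE _ _ dphi) (pderiv_coord _ _ _ dphi).
Qed.

Lemma jacobian_smooth : mx_smooth_on U J.
Proof.
move=> i a; have phia : smooth_on U (fun z => phi z 0 a) by exact: smooth_on_entry.
apply: (smooth_on_eq oU _ (smooth_on_pderiv i phia)) => y Uy.
by rewrite jacobian_pderiv.
Qed.

Lemma jacobian_unit y : U y -> J y \in unitmx.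
Proof.
move=> Uy; have : g y \in unitmx by case: gU => _ _ _; apply.
by rewrite (ggJ Uy) !unitmxE !det_mulmx !unitrM => /andP[/andP[]].
Qed.

Lemma pderiv_jacobian_sym i j a y : U y -> pderiv i J y j a = pderiv j J y i a.
Proof.
move=> Uy; have E k l : pderiv k J y l a = pderiv k (pderiv l (fun z => phi z 0 a)) y.
  rewrite (mx_smooth_on_pderivE k jacobian_smooth Uy) mxE.
  by apply: near_eq_derive; apply: near_open oU Uy _ => z Uz; exact: jacobian_pderiv.
apply: (etrans (E i j)); apply: (etrans _ (esym (E j i))).
by apply: pderivC oU _ Uy; exact: smooth_on_entry.
Qed.

(** Only the form index is pulled back; rows and columns still refer to the target coordinates. *)
Let theta i (y : 'rV[R]_n) : 'M[R]_n :=
  \sum_a J y i a *: connection_mx g' a (phi y).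

Let theta_sym i j d y : U y -> (J y *m theta i y) j d = (J y *m theta j y) i d.
Proof.
move=> Uy; rewrite /theta; move: (J y) => Jy; rewrite !mulmx_sumr !summxE.
under [LHS]eq_bigr do rewrite -scalemxAr mxE mxE mulr_sumr.
under [RHS]eq_bigr do rewrite -scalemxAr mxE mxE mulr_sumr.
rewrite exchange_big /=; apply: eq_bigr => a _; apply: eq_bigr => b _.
by rewrite (connection_sym gV b a d (phiUV Uy)); ring.
Qed.

Let derivable_pullback (F : 'rV[R]_n -> 'M[R]_n) y (v : 'rV[R]_n) : U y ->
  (forall a b, differentiable (fun z => F z a b) (phi y)) ->
  derivable (fun z => F (phi z)) y v.
Proof.
move=> Uy dF; apply: derivable_entries => a b.
apply: (@differentiable_comp _ _ _ _ phi (fun z => F z a b)) => //.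
exact: smooth_on_differentiable phis Uy.
Qed.

Let pderiv_pullback (F : 'rV[R]_n -> 'M[R]_n) y i : U y ->
  (forall a b, differentiable (fun z => F z a b) (phi y)) ->
  pderiv i (fun z => F (phi z)) y = \sum_a J y i a *: pderiv a F (phi y).
Proof.
move=> Uy dF.
have dFE a : pderiv a F (phi y) = \matrix_(c, d) pderiv a (fun z => F z c d) (phi y).
  by rewrite {1}/pderiv derive_mx //; exact: derivable_entries.
under eq_bigr => a _ do rewrite dFE.
rewrite {1}/pderiv derive_mx; last exact: derivable_pullback.
apply/matrixP => c d; rewrite mxE summxE.
have := @pderiv_comp _ _ _ _ phi (fun z => F z c d) y i
  (smooth_on_differentiable phis Uy) (dF c d).
rewrite /pderiv => ->; apply: eq_bigr => a _.
by rewrite [RHS]mxE [X in _ * X]mxE.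
Qed.

Let dg' a b c y : U y -> differentiable (fun z => g' z b c) (phi y).
Proof. by case: gV => _ gs _ _ Uy; exact: smooth_on_differentiable (gs b c) (phiUV Uy). Qed.

Lemma connection_transform i y : U y ->
  connection_mx g i y *m J y = pderiv i J y + J y *m theta i y.
Proof.
move=> Uy; have uJ := jacobian_unit Uy; have Vy := phiUV Uy.
have gT : (g y)^T = g y by case: gU => _ _ H _; exact: H.
have gT' : (g' (phi y))^T = g' (phi y) by case: gV => _ _ H _; exact: H.
have ug : g y \in unitmx by case: gU => _ _ _; exact.
pose H k := (pderiv k J y + J y *m theta k y) *m invmx (J y).
suff -> : connection_mx g i y = H i by rewrite /H mulmxKV.
apply/esym; apply: (koszul_unique (dg := fun l => pderiv l g y)) => //.
  move=> a b k; rewrite /H [LHS]mxE [RHS]mxE; apply: eq_bigr => c _; congr (_ * _).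
  rewrite [LHS]mxE [RHS]mxE; congr (_ + _); first exact: pderiv_jacobian_sym.
  exact: theta_sym.
(* Metric compatibility of [H]: the product rule for [J *m g' *m J^T], where the derivative of [g']
   along [phi] is given by compatibility of the target connection. *)
move=> k.
have -> : H k *m g y = (pderiv k J y + J y *m theta k y) *m g' (phi y) *m (J y)^T.
  by rewrite /H (ggJ Uy) !mulmxA mulmxKV.
have -> : pderiv k g y = pderiv k (fun z => J z *m g' (phi z) *m (J z)^T) y.
  by apply: near_eq_derive; exact: near_open ggJ.
have dJ v : derivable J y v by exact: mx_smooth_on_derivable jacobian_smooth Uy.
have dgp v : derivable (fun z => g' (phi z)) y v.
  by apply: derivable_pullback => // a b; exact: dg'.
have dJg v : derivable (fun z => J z *m g' (phi z)) y v by exact: derivable_mulmx.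
have E1 := derive_mulmx (dJg (delta_mx 0 k)) (derivable_trmx (dJ (delta_mx 0 k))).
rewrite (derive_mulmx (dJ _) (dgp _)) (derive_trmx (dJ _)) in E1.
rewrite -!/(pderiv _ _ _) in E1.
rewrite [LHS]E1 pderiv_pullback //; last by move=> a b; exact: dg'.
have -> : \sum_a J y k a *: pderiv a g' (phi y) =
   theta k y *m g' (phi y) + (theta k y *m g' (phi y))^T.
  rewrite /theta mulmx_suml linear_sum /= -big_split /=; apply: eq_bigr => a _.
  by rewrite (connection_compat gV) // scalerDr -scalemxAl linearZ.
move: (pderiv k J y) (theta k y) (J y) (g' (phi y)) gT' => D T Jy G GT.
have tD (A B : 'M[R]_n) : (A + B)^T = A^T + B^T by exact: raddfD.
rewrite !(mulmxDl, mulmxDr, tD) !trmx_mul !trmxK !GT !mulmxA ?(mulmxDl, mulmxDr, tD) ?trmx_mul ?mulmxA.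
rewrite -!addrA; congr (_ + (_ + _)); exact: addrC.
Qed.

Lemma derivable_theta i x v : U x -> derivable (theta i) x v.
Proof.
move=> Ux; apply: derivable_entries => a b.
rewrite (_ : (fun y => _) =
  (fun y => \sum_c J y i c * connection_mx g' c (phi y) a b)); last first.
  by apply/funext => y; rewrite summxE; apply: eq_bigr => c _; rewrite [LHS]mxE.
apply: differentiable_bigsum => c; apply: differentiableM.
  exact: smooth_on_differentiable (jacobian_smooth i c) Ux.
apply: (@differentiable_comp _ _ _ _ phi (fun z => connection_mx g' c z a b)).
  exact: smooth_on_differentiable phis Ux.
by apply: (differentiable_connection gV); exact: phiUV.
Qed.

Lemma pderiv_theta i j x : U x ->
  pderiv j (theta i) x = \sum_a (pderiv j J x i a *: connection_mx g' a (phi x))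
    + \sum_a \sum_b (J x i a * J x j b) *: pderiv b (connection_mx g' a) (phi x).
Proof.
move=> Ux.
have dJ a : derivable (fun y => J y i a) x (delta_mx 0 j).
  exact: diff_derivable (smooth_on_differentiable (jacobian_smooth i a) Ux).
have dG a : derivable (fun y => connection_mx g' a (phi y)) x (delta_mx 0 j).
  by apply: derivable_pullback => // c d; apply: (differentiable_connection gV); exact: phiUV.
have -> : theta i = \sum_a (fun y => J y i a *: connection_mx g' a (phi y)).
  by apply/funext => y; rewrite fct_sumE.
rewrite {1}/pderiv derive_sum; last by move=> a; exact: derivable_scale.
rewrite -big_split /=; apply: eq_bigr => a _.
rewrite (derive_scale (dJ a) (dG a)); congr (_ *: _ + _).
  by rewrite (mx_smooth_on_pderivE j jacobian_smooth Ux) mxE.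
have := @pderiv_pullback (connection_mx g' a) x j Ux.
rewrite {1}/pderiv => ->; last by move=> c d; apply: (differentiable_connection gV); exact: phiUV.
by rewrite scaler_sumr; apply: eq_bigr => b _; rewrite scalerA.
Qed.

Lemma curvature_transform i j x : U x ->
  curvature_mx g i j x *m J x =
  \sum_a \sum_b (J x i a * J x j b) *: (J x *m curvature_mx g' a b (phi x)).
Proof.
move=> Ux.
have dJ v : derivable J x v by exact: mx_smooth_on_derivable jacobian_smooth Ux.
have E k l : pderiv k (connection_mx g l) x *m J x + connection_mx g l x *m pderiv k J x =
    pderiv k (pderiv l J) x + (pderiv k J x *m theta l x + J x *m pderiv k (theta l) x).
  have dG : derivable (connection_mx g l) x (delta_mx 0 k).
    exact: (derivable_connection gU).
  have dT : derivable (theta l) x (delta_mx 0 k) by exact: derivable_theta.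
  have dJJ : derivable (pderiv l J) x (delta_mx 0 k).
    exact: mx_smooth_on_derivable (mx_smooth_on_pderiv l oU jacobian_smooth) Ux.
  have := deriveD dJJ (derivable_mulmx (dJ (delta_mx 0 k)) dT).
  rewrite (derive_mulmx (dJ _) dT) => <-.
  apply: (etrans (esym (derive_mulmx dG (dJ _)))).
  by apply: near_eq_derive; apply: near_open oU Ux _ => y Uy; exact: connection_transform.
(* Commuting the second derivatives of [J] provides the common term [DD] of [curvature_gauge]. *)
have Eji := E j i; rewrite -(mx_pderivC i j oU jacobian_smooth Ux) in Eji.
rewrite /curvature_mx.
rewrite (curvature_gauge (connection_transform i Ux) (connection_transform j Ux) (E i j) Eji).
under [RHS]eq_bigr do under eq_bigr do rewrite scalemxAr.
under [RHS]eq_bigr do rewrite -mulmx_sumr.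
rewrite -mulmx_sumr; congr (_ *m _).
rewrite (pderiv_theta j i Ux) (pderiv_theta i j Ux).
(* The part of the derivatives of [theta] that contains second derivatives of [phi] is symmetric in
   [i], [j] and drops out of the difference. *)
have -> : \sum_a pderiv i J x j a *: connection_mx g' a (phi x) =
    \sum_a pderiv j J x i a *: connection_mx g' a (phi x).
  by apply: eq_bigr => a _; congr (_ *: _); exact: pderiv_jacobian_sym.
have TT k l : theta k x *m theta l x = \sum_a \sum_b
    (J x k a * J x l b) *: (connection_mx g' a (phi x) *m connection_mx g' b (phi x)).
  rewrite /theta mulmx_suml; apply: eq_bigr => a _.
  rewrite mulmx_sumr; apply: eq_bigr => b _.
  by rewrite -scalemxAl -scalemxAr scalerA.
rewrite !TT /curvature_mx opprD [X in X + _]addrACA subrr add0r.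
have reorder (Jx : 'M[R]_n) (P : 'I_n -> 'M[R]_n) (dP : 'I_n -> 'I_n -> 'M[R]_n) :
    \sum_a \sum_b (Jx j a * Jx i b) *: dP b a
      - \sum_a \sum_b (Jx i a * Jx j b) *: dP b a
      + (\sum_a \sum_b (Jx j a * Jx i b) *: (P a *m P b)
      - \sum_a \sum_b (Jx i a * Jx j b) *: (P a *m P b)) =
    \sum_a \sum_b (Jx i a * Jx j b) *:
      (dP a b - dP b a + (P b *m P a - P a *m P b)).
  have -> : \sum_a \sum_b (Jx j a * Jx i b) *: dP b a =
      \sum_a \sum_b (Jx i a * Jx j b) *: dP a b.
    rewrite exchange_big; apply: eq_bigr => a _; apply: eq_bigr => b _.
    by rewrite mulrC.
  have -> : \sum_a \sum_b (Jx j a * Jx i b) *: (P a *m P b) =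
      \sum_a \sum_b (Jx i a * Jx j b) *: (P b *m P a).
    rewrite exchange_big; apply: eq_bigr => a _; apply: eq_bigr => b _.
    by rewrite mulrC.
  rewrite -!sumrB -big_split /=; apply: eq_bigr => a _.
  rewrite -!sumrB -big_split /=; apply: eq_bigr => b _.
  by rewrite -!scalerBr -scalerDr.
exact: (reorder (J x) (fun a => connection_mx g' a (phi x))
  (fun b a => pderiv b (connection_mx g' a) (phi x))).
Qed.

End coordinate_change.

(** * Pointwise algebra of the Weyl tensor *)

Section weyl_algebra.
Variables (R : realType) (n : nat).
Implicit Types (J K A B G : 'M[R]_n) (T C : 'I_n -> 'I_n -> 'I_n -> 'I_n -> R)
  (Rm : 'I_n -> 'I_n -> 'M[R]_n).

Lemma tensor22_transform_ext J K T1 T1' T2 T2' :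
  (forall i j k l, T1 i j k l = T2 i j k l) ->
  (forall i j k l, T1' i j k l = T2' i j k l) ->
  tensor22_transform J K T1 T1' -> tensor22_transform J K T2 T2'.
Proof.
move=> E E' h i j k l; rewrite -E h; apply: eq_bigr => a _; apply: eq_bigr => b _.
by apply: eq_bigr => c _; apply: eq_bigr => d _; rewrite E'.
Qed.

(** The Weyl tensor with curvature, Ricci tensor and scalar curvature as independent arguments, so
    that the same transformation lemma covers both changes of coordinates and the exchange of the
    two index pairs. *)
Definition weyl_comb T B (s : R) i j k l : R :=
  T i j k l
  - (n%:R - 2)^-1 *
      (kron R i k * B j l - kron R j k * B i l
       + kron R j l * B i k - kron R i l * B j k)
  + s / ((n%:R - 1) * (n%:R - 2)) *
      (kron R i k * kron R j l - kron R i l * kron R j k).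

Lemma weyl_comb_tr T B s i j k l :
  weyl_comb T B s k l i j = weyl_comb (fun i j k l => T k l i j) B^T s i j k l.
Proof.
rewrite /weyl_comb !mxE /kron !(eq_sym i) !(eq_sym j); congr (_ - _ * _ + _ * _).
  ring.
by rewrite (mulrC (l == i)%:R).
Qed.

Lemma weyl_comb_transform J K T T' B B' s : J *m K = 1%:M ->
  tensor22_transform J K T T' -> B = J *m B' *m K ->
  tensor22_transform J K (weyl_comb T B s) (weyl_comb T' B' s).
Proof.
move=> JK hT hB.
have h1 : 1%:M = J *m 1%:M *m K by rewrite mulmx1 JK.
pose c : R := (n%:R - 2)^-1; pose d := s / ((n%:R - 1) * (n%:R - 2)).
have := tensor22_transformD hT
  (tensor22_transformD
    (tensor22_transformZ (- c)
       (tensor22_transformD (tensor22_transform_prod h1 hB)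
                            (tensor22_transform_prod hB h1)))
  (tensor22_transformD
    (tensor22_transformZ c
       (tensor22_transformD (tensor22_transform_crossprod h1 hB)
                            (tensor22_transform_crossprod hB h1)))
  (tensor22_transformD
    (tensor22_transformZ d (tensor22_transform_prod h1 h1))
    (tensor22_transformZ (- d) (tensor22_transform_crossprod h1 h1))))).
have E (X : 'I_n -> 'I_n -> 'I_n -> 'I_n -> R) (Y : 'M[R]_n) i j k l : X i j k l + (- c * ((1%:M : 'M[R]_n) i k * Y j l + Y i k * (1%:M : 'M[R]_n) j l) +
    (c * ((1%:M : 'M[R]_n) i l * Y j k + Y i l * (1%:M : 'M[R]_n) j k) +
    (d * ((1%:M : 'M[R]_n) i k * (1%:M : 'M[R]_n) j l) +
     - d * ((1%:M : 'M[R]_n) i l * (1%:M : 'M[R]_n) j k)))) = weyl_comb X Y s i j k l.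
  by rewrite !mxE /weyl_comb /kron -/c -/d; ring.
apply: tensor22_transform_ext => i j k l; exact: E.
Qed.

Definition raise_mx G Rm i j k l : R := (invmx G *m Rm i j) l k.

Definition ricci_mx Rm : 'M[R]_n := \matrix_(i, j) \sum_k Rm k j i k.

Definition ricci_up_mx G Rm : 'M[R]_n := (invmx G *m ricci_mx Rm)^T.

Definition weyl_of G Rm : 'I_n -> 'I_n -> 'I_n -> 'I_n -> R :=
  weyl_comb (raise_mx G Rm) (ricci_up_mx G Rm) (\tr (ricci_up_mx G Rm)).

Section change_of_frame.
Variables (J G G' : 'M[R]_n) (Rm Rm' : 'I_n -> 'I_n -> 'M[R]_n).
Hypothesis uJ : J \in unitmx.
Hypothesis uG : G \in unitmx.
Hypothesis GJ : G = J *m G' *m J^T.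
Hypothesis RmJ : forall i j, Rm i j *m J =
  \sum_a \sum_b (J i a * J j b) *: (J *m Rm' a b).
Local Notation K := (invmx J).

Lemma curvature_change_of_frame i j : Rm i j = \sum_a \sum_b (J i a * J j b) *: (J *m Rm' a b *m K).
Proof.
rewrite -[LHS](mulmxK uJ) RmJ mulmx_suml; apply: eq_bigr => a _.
by rewrite mulmx_suml; apply: eq_bigr => b _; rewrite -scalemxAl.
Qed.

Lemma invmx_congruence : invmx G = K^T *m invmx G' *m K.
Proof.
have uG' : G' \in unitmx.
  by move: uG; rewrite GJ !unitmxE !det_mulmx !unitrM => /andP[/andP[]].
apply: (can_inj (mulKmx uG)); rewrite mulmxV // GJ -!mulmxA.
rewrite (mulmxA J^T) -trmx_mul mulVmx // trmx1 mul1mx.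
by rewrite (mulmxA G') mulmxV // mul1mx mulmxV.
Qed.

Lemma raise_mx_transform :
  tensor22_transform J K (raise_mx G Rm) (raise_mx G' Rm').
Proof.
move=> i j k l; rewrite /raise_mx curvature_change_of_frame mulmx_sumr summxE; apply: eq_bigr => a _.
rewrite mulmx_sumr summxE; apply: eq_bigr => b _.
rewrite -scalemxAr mxE invmx_congruence -!mulmxA (mulmxA K J) mulVmx // mul1mx !mulmxA.
rewrite -(mulmxA K^T) mulmx3_entry exchange_big /= mulr_sumr; apply: eq_bigr => c _.
rewrite mulr_sumr; apply: eq_bigr => d _; rewrite [_^T _ _]mxE; ring.
Qed.

Lemma ricci_mx_transform : ricci_mx Rm = J *m ricci_mx Rm' *m J^T.
Proof.
apply/matrixP => i j; rewrite mxE.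
under eq_bigr => k _.
  rewrite curvature_change_of_frame summxE.
  under eq_bigr => a _.
    rewrite summxE; under eq_bigr => b _ do rewrite mxE.
    over.
  over.
rewrite exchange_big /=.
transitivity (\sum_a \sum_b J j b * \sum_k ((J *m Rm' a b) i k * \sum_c (K k c * J c a))).
  apply: eq_bigr => a _; rewrite exchange_big /=; apply: eq_bigr => b _.
  under eq_bigr => k _ do rewrite mxE mulr_sumr.
  rewrite exchange_big /= mulr_sumr; apply: eq_bigr => k _.
  by rewrite mulr_sumr mulr_sumr; apply: eq_bigr => c _; ring.
have E (k a : 'I_n) : \sum_c K k c * J c a = (k == a)%:R.
  by have /matrixP/(_ k a) := mulVmx uJ; rewrite !mxE.
transitivity (\sum_a \sum_b J j b * (J *m Rm' a b) i a).
  apply: eq_bigr => a _; apply: eq_bigr => b _; congr (_ * _).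
  by under eq_bigr => k _ do rewrite E mulrC; rewrite sum_kron_l.
rewrite exchange_big /= [RHS]mxE; apply: eq_bigr => b _.
rewrite -mulr_sumr mulrC [_^T _ _]mxE; congr (_ * _).
under eq_bigr => a _ do rewrite mxE.
rewrite exchange_big mxE /=; apply: eq_bigr => c _.
by rewrite [ricci_mx _ _ _]mxE mulr_sumr.
Qed.

Lemma ricci_up_mx_transform : ricci_up_mx G Rm = J *m ricci_up_mx G' Rm' *m K.
Proof.
rewrite /ricci_up_mx ricci_mx_transform invmx_congruence -!mulmxA (mulmxA K J).
by rewrite mulVmx // mul1mx !trmx_mul !trmxK !mulmxA.
Qed.

Lemma weyl_of_transform : tensor22_transform J K (weyl_of G Rm) (weyl_of G' Rm').
Proof.
have tr_eq : \tr (ricci_up_mx G Rm) = \tr (ricci_up_mx G' Rm').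
  by rewrite ricci_up_mx_transform mxtrace_mulC mulmxA mulVmx // mul1mx.
rewrite /weyl_of tr_eq; apply: weyl_comb_transform.
- exact: mulmxV.
- exact: raise_mx_transform.
- exact: ricci_up_mx_transform.
Qed.

End change_of_frame.

Section pair_symmetry.
Variables (G : 'M[R]_n) (Rm : 'I_n -> 'I_n -> 'M[R]_n).
Hypothesis uG : G \in unitmx.
Hypothesis GT : G^T = G.
Hypothesis Rm_ij : forall i j, Rm j i = - Rm i j.
Hypothesis bianchi : forall i j k l, Rm i j k l + Rm j k i l + Rm k i j l = 0.
Hypothesis Rm_kl : forall i j, Rm i j *m G + (Rm i j *m G)^T = 0.

Let L i j k l := (Rm i j *m G) k l.

Let a1 a b c d : L b a c d = - L a b c d.
Proof. by rewrite /L Rm_ij mulNmx mxE. Qed.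

Let a2 a b c d : L a b d c = - L a b c d.
Proof.
have /matrixP/(_ d c) := Rm_kl a b; rewrite mxE [(_^T) _ _]mxE [RHS]mxE.
by move=> /eqP; rewrite addr_eq0 => /eqP.
Qed.

Lemma lowered_pair_sym i j k l : L i j k l = L k l i j.
Proof.
have b1 a b c d : L a b c d + L b c a d + L c a b d = 0.
  rewrite /L !mxE -!big_split big1 //= => m _.
  by rewrite -!mulrDl bianchi mul0r.
(* The cyclic identity started at each of the four indices. Once the antisymmetries have normalized
   the terms, [A1 + A2 - A3 - A4] is twice [L i j k l - L k l i j]. *)
have A1 := b1 i j k l; have A2 := b1 j k l i.
have A3 := b1 k l i j; have A4 := b1 l i j k.
rewrite (a2 j k i l) (a2 k l i j) in A2; rewrite (a2 i k j l) (a1 k i j l) opprK in A3.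
rewrite (a2 l i k j) (a2 i j k l) (a1 l j i k) (a2 l j k i) opprK in A4.
lra.
Qed.

Let invGT : (invmx G)^T = invmx G. Proof. by rewrite trmx_inv GT. Qed.

Lemma ricci_mx_sym : (ricci_mx Rm)^T = ricci_mx Rm.
Proof.
have E i j : ricci_mx Rm i j = \sum_k \sum_l L k j i l * invmx G l k.
  by rewrite mxE; apply: eq_bigr => k _; rewrite -[in LHS](mulmxK uG (Rm k j)) mxE.
apply/matrixP => i j; rewrite [LHS]mxE !E exchange_big /=.
apply: eq_bigr => k _; apply: eq_bigr => l _.
rewrite (lowered_pair_sym k j i l); congr (_ * _); last by rewrite -{1}invGT mxE.
by rewrite (a1 i l) (a2 i l k j) opprK.
Qed.

Lemma ricci_up_mx_sym : ricci_up_mx G Rm = G *m (ricci_up_mx G Rm)^T *m invmx G.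
Proof.
by rewrite /ricci_up_mx trmxK mulKVmx // trmx_mul invGT ricci_mx_sym.
Qed.

(* C_ijkl = C_klij with indices moved by G; put as a change of frame by G, it
   gives the self-adjointness of W(m) through W_mx_transform. *)
Lemma weyl_of_pair_sym : tensor22_transform G (invmx G) (weyl_of G Rm)
  (fun i j k l => weyl_of G Rm k l i j).
Proof.
have E i j k l : weyl_of G Rm k l i j = weyl_comb (fun i j k l => raise_mx G Rm k l i j)
    (ricci_up_mx G Rm)^T (\tr (ricci_up_mx G Rm)) i j k l by exact: weyl_comb_tr.
apply: (tensor22_transform_ext (fun _ _ _ _ => erefl) (fun i j k l => esym (E i j k l))).
apply: weyl_comb_transform; first exact: mulmxV.
  move=> i j k l; rewrite sum_pair4 exchange_big /=.
  rewrite /raise_mx -(mulmxK uG (Rm i j)) mulmxA mulmx3_entry exchange_big pair_big /=.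
  apply: eq_bigr => -[c d] _ /=.
  have -> : (Rm i j *m G) d c = (Rm c d *m G) j i.
    by rewrite -/(L i j d c) -/(L c d j i) a2 lowered_pair_sym -a2.
  rewrite -(pair_big predT predT (fun a b => G i a * G j b * (invmx G *m Rm c d) b a *
    (invmx G c k * invmx G d l))) /=.
  rewrite -[in LHS](mulKVmx uG (Rm c d)) -mulmxA mulmxA mulmx3_entry exchange_big /=.
  rewrite mulr_sumr mulr_suml; apply: eq_bigr => a _.
  rewrite mulr_sumr mulr_suml; apply: eq_bigr => b _.
  have -> : invmx G l d = invmx G d l by rewrite -{1}invGT mxE.
  have -> : G a i = G i a by rewrite -{1}GT mxE.
  ring.
exact: ricci_up_mx_sym.
Qed.

End pair_symmetry.

End weyl_algebra.

(** * Isometries *)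

Section local_weyl.
Variables (R : realType) (n : nat).
Implicit Types (U V : set 'rV[R]_n) (g : 'rV[R]_n -> 'M[R]_n) (x : 'rV[R]_n).

Lemma ricciE U g x i j : local_metric U g -> U x ->
  ricci g i j x = ricci_mx (fun i j => curvature_mx g i j x) i j.
Proof. by move=> gU Ux; rewrite mxE; apply: eq_bigr => k _; rewrite (riemannE gU). Qed.

Lemma ricci_upE U g x i k : local_metric U g -> U x ->
  ricci_up g i k x = ricci_up_mx (g x) (fun i j => curvature_mx g i j x) i k.
Proof.
move=> gU Ux; rewrite [RHS]mxE [RHS]mxE; apply: eq_bigr => m _.
by rewrite (ricciE _ _ gU Ux).
Qed.

Lemma weylE U g x i j k l : local_metric U g -> U x ->
  weyl g x i j k l = weyl_of (g x) (fun i j => curvature_mx g i j x) i j k l.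
Proof.
move=> gU Ux; rewrite /weyl /weyl_of /weyl_comb !(ricci_upE _ _ gU Ux).
have -> : scalar_curv g x = \tr (ricci_up_mx (g x) (fun i j => curvature_mx g i j x)).
  by apply: eq_bigr => m _; rewrite (ricci_upE _ _ gU Ux).
congr (_ - _ + _); rewrite /riemann_up /raise_mx [RHS]mxE; apply: eq_bigr => m _.
by rewrite (riemannE gU).
Qed.

Lemma weyl_pair_sym U g x : local_metric U g -> U x ->
  tensor22_transform (g x) (invmx (g x)) (weyl g x) (fun i j k l => weyl g x k l i j).
Proof.
move=> gU Ux; have [_ _ gT gu] := gU.
apply: (tensor22_transform_ext (fun i j k l => esym (weylE i j k l gU Ux))
  (fun i j k l => esym (weylE k l i j gU Ux))).
apply: weyl_of_pair_sym; [exact: gu | exact: gT | | |].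
- by move=> i j; exact: curvature_antisym_ij.
- by move=> i j k l; exact: (curvature_bianchi gU).
- by move=> i j; exact: (curvature_antisym_kl gU).
Qed.

Lemma ricci_sym U g x : local_metric U g -> U x ->
  (ricci_mx (fun i j => curvature_mx g i j x))^T =
  ricci_mx (fun i j => curvature_mx g i j x).
Proof.
move=> gU Ux; have [_ _ gT gu] := gU.
apply: (@ricci_mx_sym _ _ (g x)); [exact: gu | exact: gT | | |].
- by move=> i j; exact: curvature_antisym_ij.
- by move=> i j k l; exact: (curvature_bianchi gU).
- by move=> i j; exact: (curvature_antisym_kl gU).
Qed.

Lemma coordinate_change_curvature U V (phi : 'rV[R]_n -> 'rV[R]_n) g g' x :
  local_metric U g -> local_metric V g' -> smooth_on U phi ->
  (forall y, U y -> V (phi y)) ->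
  (forall y, U y -> g y = jacobian phi y *m g' (phi y) *m (jacobian phi y)^T) ->
  U x ->
  [/\ jacobian phi x \in unitmx,
   ricci_mx (fun i j => curvature_mx g i j x) =
     jacobian phi x *m ricci_mx (fun i j => curvature_mx g' i j (phi x))
       *m (jacobian phi x)^T &
   tensor22_transform (jacobian phi x) (invmx (jacobian phi x))
     (weyl g x) (weyl g' (phi x))].
Proof.
move=> gU gV phis phiUV ggJ Ux.
have uJ := jacobian_unit gU ggJ Ux.
have RmJ i j := curvature_transform gU gV phis phiUV ggJ i j Ux.
split=> //; first exact: ricci_mx_transform.
apply: (tensor22_transform_ext (fun i j k l => esym (weylE i j k l gU Ux))
  (fun i j k l => esym (weylE i j k l gV (phiUV x Ux)))).
by apply: weyl_of_transform => //; [case: gU => _ _ _; exact | exact: ggJ].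
Qed.

End local_weyl.

Lemma posdef_unitmx (R : realFieldType) (n : nat) (G : 'M[R]_n) :
  (forall v : 'rV_n, v != 0 -> 0 < (v *m G *m v^T) 0 0) -> G \in unitmx.
Proof.
move=> Gpos; rewrite -row_free_unit -kermx_eq0; apply/eqP/row_matrixP => i.
rewrite row0; apply/eqP/negPn/negP => /Gpos.
by rewrite (sub_kermxP (row_sub _ _)) mul0mx mxE ltxx.
Qed.

(** * Smoothness of a single translation, and isometries in charts *)

Section slices.
Variables (R : realType) (n1 n2 : nat) (W : normedModType R) (u : 'rV[R]_n1).

Lemma pderiv_slice (H : 'rV[R]_(n1 + n2) -> W) i :
  pderiv i (fun x => H (row_mx u x)) =
  (fun x => pderiv (rshift n1 i) H (row_mx u x)).
Proof.
apply/funext => x; rewrite /pderiv /derive.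
have -> // : (fun h : R => h^-1 *: (((fun x => H (row_mx u x)) \o shift x) (h *: delta_mx 0 i)
      - H (row_mx u x))) =
    (fun h : R => h^-1 *: ((H \o shift (row_mx u x)) (h *: delta_mx 0 (rshift n1 i))
      - H (row_mx u x))).
apply/funext => h /=; congr (_ *: (H _ - _)).
have -> : delta_mx 0 (rshift n1 i) = row_mx 0 (delta_mx 0 i) :> 'rV[R]_(n1 + n2).
  apply/rowP => k; case: (split_ordP k) => j ->.
    by rewrite row_mxEl !mxE eq_lrshift andbF.
  by rewrite row_mxEr !mxE eq_rshift.
by rewrite scale_row_mx scaler0 add_row_mx add0r.
Qed.

Lemma differentiable_slice x : differentiable (fun x : 'rV[R]_n2 => row_mx u x) x.
Proof.
rewrite (_ : (fun x => _) = (cst (row_mx u 0)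
   + (fun x : 'rV[R]_n2 => \sum_k x 0 k *: row_mx 0 (delta_mx 0 k)))).
  apply: differentiableD; first exact: differentiable_cst.
  by apply: differentiable_bigsum => k; apply: differentiableZl; exact: differentiable_coord.
apply/funext => y; rewrite [RHS]/(row_mx u 0 + _) {1}(row_sum_delta y).
have -> : \sum_k y 0 k *: row_mx 0 (delta_mx 0 k) =
    row_mx 0 (\sum_k y 0 k *: delta_mx 0 k) :> 'rV[R]_(n1 + n2).
  rewrite (big_morph (fun z : 'rV[R]_n2 => row_mx (0 : 'rV[R]_n1) z)
    (id1 := 0) (op1 := +%R)).
  - by apply: eq_bigr => k _; rewrite scale_row_mx scaler0.
  - by move=> a b; rewrite add_row_mx addr0.
  - exact: row_mx0.
by apply: (etrans _ (esym (add_row_mx u 0 0 _))); rewrite addr0 add0r.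
Qed.

(** The action is smooth jointly in the group element and the point. With the group coordinates
    fixed, iterated partial derivatives are iterated partial derivatives of [F] in the directions of
    the second block. *)
Lemma smooth_on_slice (U : set 'rV[R]_n2) (U' : set 'rV[R]_(n1 + n2)) (F : 'rV[R]_(n1 + n2) -> W) :
  smooth_on U' F -> (forall x, U x -> U' (row_mx u x)) ->
  smooth_on U (fun x => F (row_mx u x)).
Proof.
move=> Fs UU' s x Ux.
have -> : foldr (@pderiv R n2 W) (fun x => F (row_mx u x)) s =
    (fun x => foldr (@pderiv R _ W) F [seq rshift n1 i | i <- s] (row_mx u x)).
  by elim: s => [//|i s IH] /=; rewrite IH pderiv_slice.
apply: (@differentiable_comp _ _ _ _ (fun x => row_mx u x)); first exact: differentiable_slice.
exact: Fs (UU' _ Ux).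
Qed.

End slices.

Section charts.
Local Open Scope classical_set_scope.

(** Inside the chart image, the image of [A] is its preimage under the inverse chart, which is
    continuous there. *)
Lemma chart_image_open (R : realType) (T : topologicalType) (n : nat)
    (c : chart R T n) (A : set T) :
  is_chart c -> open A -> A `<=` cdom c -> open (cmap c @` A).
Proof.
move=> [oD oI cK cc ic] oA AD; rewrite openE => _ [x Ax <-].
have Ix : (cmap c @` cdom c) (cmap c x) by exists x => //; exact: AD.
have nI : nbhs (cmap c x) (cmap c @` cdom c) by exact: open_nbhs_nbhs.
have nA : nbhs (cmap c x) (cinv c @^-1` A).
  apply: ic => //; rewrite cK; last exact: AD.
  exact: open_nbhs_nbhs.
apply: filterS2 nI nA => _ [z Dz <-]; rewrite /preimage /= cK // => Az.
by exists z.
Qed.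

Section manifold_metric.
Variables (R : realType) (n : nat) (M : manifold R n) (g : metric_field M).
Hypothesis gM : riemannian_metric g.

Lemma riemannian_metric_posdef i x : cdom (mchart i) x -> forall v : 'rV[R]_n, v != 0 ->
  0 < (v *m g i (cmap (mchart i) x) *m v^T) 0 0.
Proof. by case: gM => _ _ gpos _ Dx; apply: gpos; exists x. Qed.

Lemma riemannian_metric_local i (U : set 'rV[R]_n) : open U ->
  U `<=` cmap (mchart i) @` cdom (mchart i) -> local_metric U (g i).
Proof.
move=> oU UD; have [gs gT gpos _] := gM; split=> //.
- by apply: smooth_on_mx => // s x Ux; apply: gs; exact: UD.
- by move=> y Uy; apply: gT; exact: UD.
- by move=> y Uy; apply: posdef_unitmx; apply: gpos; exact: UD.
Qed.

Lemma riemannian_metric_chart i :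
  local_metric (cmap (mchart i) @` cdom (mchart i)) (g i).
Proof. by apply: riemannian_metric_local => //; case: (manifold_chart i). Qed.

Lemma isometry_curvature (f : M -> M) i j x :
  continuous f -> smooth_in_charts (@mchart R n M) (@mchart R n M) f ->
  preserves_metric g f ->
  cdom (mchart i) x -> cdom (mchart j) (f x) ->
  let J := tangent_mx (mchart i) (mchart j) f x in
  let y := cmap (mchart i) x in let z := cmap (mchart j) (f x) in
  [/\ J \in unitmx, g i y = J *m g j z *m J^T,
   ricci_mx (fun a b => curvature_mx (g i) a b y) =
     J *m ricci_mx (fun a b => curvature_mx (g j) a b z) *m J^T &
   tensor22_transform J (invmx J) (weyl_at g i x) (weyl_at g j (f x))].
Proof.
move=> fc fs fg Dx Dfx J y z.
pose A := cdom (mchart i) `&` f @^-1` cdom (mchart j).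
pose U := cmap (mchart i) @` A; pose V := cmap (mchart j) @` cdom (mchart j).
have ci := manifold_chart i; have cj := manifold_chart j.
have iK : forall w, cdom (mchart i) w -> cinv (mchart i) (cmap (mchart i) w) = w by case: ci.
have oA : open A.
  apply: openI; first by case: ci.
  by apply: open_comp; [move=> w _; exact: fc | case: cj].
have oU : open U by apply: chart_image_open => // w [].
have phiE w : cdom (mchart i) w ->
    in_charts (mchart i) (mchart j) f (cmap (mchart i) w) = cmap (mchart j) (f w).
  by move=> Dw; rewrite /in_charts iK.
have gU : local_metric U (g i).
  by apply: riemannian_metric_local => // _ [w [Dw _] <-]; exists w.
have phiUV : forall y, U y -> V (in_charts (mchart i) (mchart j) f y).
  by move=> _ [w [Dw Dfw] <-]; exists (f w); rewrite ?phiE.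
have ggJ : forall y, U y -> g i y = jacobian (in_charts (mchart i) (mchart j) f) y *m
    g j (in_charts (mchart i) (mchart j) f y) *m
    (jacobian (in_charts (mchart i) (mchart j) f) y)^T.
  by move=> _ [w [Dw Dfw] <-]; rewrite phiE //; exact: fg.
have Uy : U y by exists x.
have [uJ Ric We] := coordinate_change_curvature gU (riemannian_metric_chart j)
  (fs i j) phiUV ggJ Uy.
rewrite -/y (phiE x Dx) -/z in uJ Ric We.
split; [exact: uJ | exact: fg | exact: Ric | exact: We].
Qed.

End manifold_metric.

End charts.

Lemma smooth_action_continuous (R : realType) (d n : nat)
    (G : lieGroup R d) (M : manifold R n) (act : G -> M -> M) (a : G) :
  smooth_action act -> continuous (act a).
Proof.
move=> [_ _ [actc _]] x.
apply: (@continuous_comp _ _ _ (fun x => (a, x)) (fun p : G * M => act p.1 p.2)).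
  by apply: cvg_pair; [exact: cvg_cst | exact: cvg_id].
exact: actc.
Qed.

Lemma smooth_action_in_charts (R : realType) (d n : nat)
    (G : lieGroup R d) (M : manifold R n) (act : G -> M -> M) (a : G) :
  smooth_action act -> smooth_in_charts (@mchart R n M) (@mchart R n M) (act a).
Proof.
move=> [_ _ [_ acts]] i j.
have Da := manifold_cover a.
pose ca := mchart (chart_at a).
have aK : cinv ca (cmap ca a) = a by case: (manifold_chart (chart_at a)) => _ _ ->.
have := acts (chart_at a, i) j.
set F := in_charts _ _ _ => Fs.
have -> : in_charts (mchart i) (mchart j) (act a) = (fun x => F (row_mx (cmap ca a) x)).
  by apply/funext => x; rewrite /F /in_charts /= row_mxKl row_mxKr aK.
apply: smooth_on_slice Fs _ => _ [x [Dx Dfx] <-].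
by exists (a, x).
Qed.

(** * Scalars at the base point and their transport *)

(** [J] preserves both forms [S] and [G], hence also the endomorphism [S *m invmx G] got from [S] by
    raising an index with [G]. It is applied to the Ricci tensor. *)
Lemma transform_congruence (R : realType) (n : nat) (G J S : 'M[R]_n) :
  J \in unitmx -> G \in unitmx ->
  G = J *m G *m J^T -> S = J *m S *m J^T ->
  J *m (S *m invmx G) = S *m invmx G *m J.
Proof.
move=> uJ uG GJ SJ.
rewrite [in RHS](invmx_congruence uJ uG GJ) -!mulmxA mulVmx // mulmx1.
by rewrite [in RHS]SJ -!mulmxA (mulmxA J^T) -trmx_mul mulVmx // trmx1 mul1mx.
Qed.

Lemma scalar_mx_conj (R : realType) (n : nat) (J A : 'M[R]_n) (l : R) :
  J \in unitmx -> l%:M = invmx J *m A *m J -> A = l%:M.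
Proof.
move=> uJ E; rewrite -[LHS](mulKVmx uJ) -[invmx J *m A](mulmxK uJ) -E.
by rewrite mulmxA mul_mx_scalar -scalemxAl mulmxV // scalemx1.
Qed.

Theorem mainTheorem5 (R : realType) (n d : nat)
  (G : lieGroup R d) (M : manifold R n) (act : G -> M -> M) (o : M)
  (g : metric_field M) :
  (4 <= n)%N ->
  semisimple G ->
  smooth_action act ->
  transitive_action act ->
  isotropy_irreducible act o ->
  riemannian_metric g ->
  invariant_metric act g ->
  einstein g /\
  forall m : nat, exists w : R,
    forall (c : mindex M) (x : M), cdom (mchart c) x ->
      W_scalar (weyl_at g c x) m = w /\
      forall i j : 'I_n,
        W_tensor (weyl_at g c x) m i j =
        (n%:R - 2 * m%:R) / n%:R * kron R i j * W_scalar (weyl_at g c x) m.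
Proof.
move=> n4 _ sact tact [n0 irr] gM inv.
pose Ric i x := ricci_mx (fun a b => curvature_mx (g i) a b (cmap (mchart i) x)).
have iso a i j x (Dx : cdom (mchart i) x) (Dax : cdom (mchart j) (act a x)) :=
  isometry_curvature gM (smooth_action_continuous (a := a) sact)
    (smooth_action_in_charts (a := a) sact) (inv a) Dx Dax.
pose c0 := chart_at o; have D0 : cdom (mchart c0) o by exact: manifold_cover.
pose g0 := g c0 (cmap (mchart c0) o).
have loc c := riemannian_metric_chart gM c.
have U0 : (cmap (mchart c0) @` cdom (mchart c0))%classic (cmap (mchart c0) o).
  by exists o.
have gT0 : g0^T = g0 by case: (loc c0) => _ _ H _; exact: H.
have gu0 : g0 \in unitmx by case: (loc c0) => _ _ _ H; exact: H.
pose S J := exists2 h, isotropy act o h & J = isotropy_rep act o h.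
have schur (A : 'M[R]_n) : (A *m g0)^T = A *m g0 ->
    (forall J, S J -> J *m A = A *m J) -> exists a, A = a%:M.
  move=> AT AS; apply: (real_schur n0 gT0 _ AT AS).
    exact: riemannian_metric_posdef.
  by move=> V HV; apply: irr => h v oh vV; apply: HV => //; exists h.
have isoS J : S J -> [/\ J \in unitmx, g0 = J *m g0 *m J^T,
    Ric c0 o = J *m Ric c0 o *m J^T &
    tensor22_transform J (invmx J) (weyl_at g c0 o) (weyl_at g c0 o)].
  move=> [h oh ->]; have := iso h c0 c0 o D0.
  by rewrite oh => /(_ D0).
split.
  have [l El] : exists l, Ric c0 o *m invmx g0 = l%:M.
    apply: schur => [|J /isoS[uJ gJ RJ _]]; last exact: transform_congruence.
    by rewrite mulmxKV //; exact: (ricci_sym (loc c0) U0).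
  have RicE : Ric c0 o = l *: g0 by rewrite -mul_scalar_mx -El mulmxKV.
  have scaleE (J A B : 'M[R]_n) : A = J *m Ric c0 o *m J^T ->
      B = J *m g0 *m J^T -> A = l *: B.
    by move=> -> ->; rewrite RicE -scalemxAr -scalemxAl.
  have n1 : n%:R - 1 != 0 :> R.
    by rewrite subr_eq0 pnatr_eq1; case: eqP n4 => // ->.
  (* At [o] the Ricci tensor is [l] times the metric. Both undergo the same congruence under an
     isometry, so the same [l] serves at every point. *)
  exists (l / (n%:R - 1)) => c x Dx i j.
  have [a ax] := tact x o; have := iso a c c0 x Dx.
  rewrite ax => /(_ D0) [uJ gJ RJ _].
  rewrite (ricciE i j (loc c)); last by exists x.
  by rewrite (scaleE _ _ _ RJ gJ) mxE mulrCA mulfV // mulr1.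
move=> m; exists (W_scalar (weyl_at g c0 o) m) => c x Dx.
have [a ax] := tact x o; have := iso a c c0 x Dx.
rewrite ax => /(_ D0) [uJ _ _ WJ].
have W0 : W_scalar (weyl_at g c x) m = W_scalar (weyl_at g c0 o) m.
  by apply: W_scalar_transform WJ; rewrite mulVmx.
split=> [|i j]; first exact: W0.
have [l El] : exists l, W_mx (weyl_at g c0 o) m = l%:M.
  apply: schur => [|J /isoS[uJ' _ _ WJ']].
    (* Pair symmetry, read as a change of frame by [g0], says that the transpose of W(m) is its
       conjugate by [g0]; hence W(m) times [g0] is symmetric. *)
    have := W_mx_transform m (mulVmx gu0) (weyl_pair_sym (loc c0) U0).
    rewrite W_mx_tr trmx_mul gT0 => ->.
    by rewrite -mulmxA mulKVmx.
  by rewrite {1}(W_mx_transform m (mulVmx uJ') WJ') -mulmxA mulKVmx.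
(* Conjugation by a tangent matrix fixes scalar matrices, so the value [l] found at [o] is also the
   value at [x]. *)
have Ex : W_mx (weyl_at g c x) m = l%:M.
  apply: (scalar_mx_conj uJ); apply: (etrans (esym El)).
  exact: W_mx_transform m (mulVmx uJ) WJ.
have WE p q : W_tensor (weyl_at g c x) m p q = l * kron R p q.
  by move/matrixP/(_ q p): Ex; rewrite !mxE eq_sym mulr_natr.
have nn0 : n%:R != 0 :> R by rewrite pnatr_eq0 -lt0n.
(* The trace of [l] times the identity gives [l * n = (n - 2 m) W(m)], which determines [l]. *)
have := W_tensor_trace (weyl_at g c x) m.
under eq_bigr => p _ do rewrite WE /kron eqxx mulr1.
rewrite sumr_const card_ord WE -[l *+ n]mulr_natr => ln.
by rewrite [RHS]mulrAC (mulrAC _ n%:R^-1) -ln mulfK.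
Qed.
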